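(* Let $k$ be a nonperfect field of characteristic $2$, and let $G=PGL_4$. Then there exists a connected $k$-subgroup $H$ of $G$ such that $H$ is $G$-irreducible over $k$ and $H$ has infinitely many (non-$k$-defined) overgroups in $G$.
   Context: Algebraic groups are affine and taken in the sense of Borel: (reduced) algebraic groups over an algebraic closure $\overline{k}$ of $k$, identified with their $\overline{k}$-points, with $k$-structures; $PGL_4$ has its standard $k$-structure. ''Subgroup'' means closed subgroup; a $k$-subgroup is a closed subgroup defined over $k$. A closed subgroup $H$ of a connected reductive $k$-group $G$ is $G$-irreducible over $k$ if it is not contained in any proper parabolic subgroup of $G$ that is defined over $k$. An overgroup of $H$ is a closed subgroup of $G$ (over $\overline{k}$) containing $H$; ''non-$k$-defined'' indicates that the overgroups concerned are not defined over $k$. *)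

(* Defs.v *)
From HB Require Import structures.
From mathcomp Require Import all_boot all_order all_algebra.
From mathcomp Require Import mpoly.
From mathcomp Require Import boolp classical_sets cardinality topology.

Set Implicit Arguments.
Unset Strict Implicit.
Unset Printing Implicit Defensive.

Import GRing.Theory.
Local Open Scope ring_scope.
Local Open Scope classical_set_scope.
Local Open Scope quotient_scope.

(* Vacuously true in characteristic 0. *)
Definition perfect_field (k : fieldType) : Prop :=
  forall p, p \in [pchar k] -> forall x : k, exists y : k, y ^+ p = x.

Section AbstractGroups.
Local Open Scope group_scope.
Variable G : groupType.

Definition subgroup (H : set G) : Prop :=
  H 1 /\ forall x y, H x -> H y -> H (x * y^-1).

(* The abstract derived series, with no closure taken: solvability of an
   algebraic group is that of its group of points. *)
Definition derived_subgroup (H : set G) : set G :=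
  smallest subgroup [set z | exists x y, [/\ H x, H y & z = [~ x, y]]].

Definition solvable_subgroup (H : set G) : Prop :=
  exists m, iter m derived_subgroup H = [set 1].

End AbstractGroups.

Section GeneralLinear.
Variables (K : fieldType) (n : nat).

(* Varieties are identified with their sets of K-points, which is only adequate
   for K algebraically closed. *)
Definition GL := {A : 'M[K]_n | A \in unitmx}.
HB.instance Definition _ := Choice.on GL.

Definition gl_one : GL := exist _ 1%:M (unitmx1 K n).

Definition gl_mul (A B : GL) : GL :=
  exist _ (val A *m val B) (etrans (unitmx_mul _ _) (introT andP (conj (valP A) (valP B)))).

Definition gl_inv (A : GL) : GL :=
  exist _ (invmx (val A)) (etrans (unitmx_inv _) (valP A)).

Fact gl_mulA : associative gl_mul.
Proof. by move=> A B C; apply/val_inj; rewrite /= mulmxA. Qed.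

Fact gl_mul1 : left_id gl_one gl_mul.
Proof. by move=> A; apply/val_inj; rewrite /= mul1mx. Qed.

Fact gl_mul1r : right_id gl_one gl_mul.
Proof. by move=> A; apply/val_inj; rewrite /= mulmx1. Qed.

Fact gl_mulV : left_inverse gl_one gl_inv gl_mul.
Proof. by move=> A; apply/val_inj; rewrite /= mulVmx ?(valP A). Qed.

Fact gl_mulVr : right_inverse gl_one gl_inv gl_mul.
Proof. by move=> A; apply/val_inj; rewrite /= mulmxV ?(valP A). Qed.

HB.instance Definition _ :=
  isGroup.Build GL gl_mulA gl_mul1 gl_mul1r gl_mulV gl_mulVr.

Definition proportional (A B : GL) : bool :=
  `[< exists2 c : K, c != 0 & val A = c *: val B >].

Fact proportional_refl : reflexive proportional.
Proof. by move=> A; apply/asboolP; exists 1; rewrite ?oner_eq0 ?scale1r. Qed.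

Fact proportional_sym : ssrbool.symmetric proportional.
Proof.
suff sub A B : proportional A B -> proportional B A.
  by move=> A B; apply/idP/idP; apply: sub.
case/asboolP=> c c0 AB; apply/asboolP; exists c^-1; rewrite ?invr_eq0 //.
by rewrite AB scalerA mulVf ?scale1r.
Qed.

Fact proportional_trans : transitive proportional.
Proof.
move=> B A C /asboolP[c c0 AB] /asboolP[d d0 BC]; apply/asboolP.
by exists (c * d); rewrite ?mulf_neq0 // AB BC scalerA.
Qed.

Canonical proportional_equiv :=
  EquivRel proportional proportional_refl proportional_sym proportional_trans.

Definition PGL := {eq_quot proportional}.
HB.instance Definition _ := Choice.on PGL.
HB.instance Definition _ := EqQuotient.on PGL.

End GeneralLinear.

Section Projective.
Variables (K : fieldType) (n : nat).
Local Notation GL := (GL K n).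
Local Notation PGL := (PGL K n).

Fact pgl_eqP (A B : GL) :
  (exists2 c : K, c != 0 & val A = c *: val B) <-> A = B %[mod PGL].
Proof. by split=> [h|/eqmodP/asboolP//]; apply/eqmodP/asboolP. Qed.

Definition pgl_one : PGL := \pi_PGL 1%g.
Definition pgl_mul (x y : PGL) : PGL := \pi_PGL (repr x * repr y)%g.
Definition pgl_inv (x : PGL) : PGL := \pi_PGL (repr x)^-1%g.

Lemma pi_pglM (A B : GL) : \pi_PGL (A * B)%g = pgl_mul (\pi_PGL A) (\pi_PGL B).
Proof.
rewrite /pgl_mul.
have [A' /esym/pgl_eqP[c c0 eA]] := piP PGL A.
have [B' /esym/pgl_eqP[d d0 eB]] := piP PGL B.
apply/esym/pgl_eqP; exists (c * d); first by rewrite mulf_neq0.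
by rewrite /= eA eB -scalemxAl -scalemxAr scalerA.
Qed.

Lemma pi_pglV (A : GL) : \pi_PGL A^-1%g = pgl_inv (\pi_PGL A).
Proof.
rewrite /pgl_inv; have [A' /pgl_eqP[c c0 eA]] := piP PGL A.
apply/esym/pgl_eqP; exists c; first by [].
rewrite /= eA invmxZ ?scalerA ?mulfV ?scale1r //.
by rewrite -eA; apply: valP.
Qed.

Fact pgl_mulA : associative pgl_mul.
Proof.
move=> x y z; rewrite -[x]reprK -[y]reprK -[z]reprK.
rewrite -(pi_pglM (repr y) (repr z)) -(pi_pglM (repr x) (repr y)).
by rewrite -(pi_pglM (repr x)) -(pi_pglM _ (repr z)) mulgA.
Qed.

Fact pgl_mul1 : left_id pgl_one pgl_mul.
Proof. by move=> x; rewrite -[x]reprK -pi_pglM mul1g. Qed.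

Fact pgl_mul1r : right_id pgl_one pgl_mul.
Proof. by move=> x; rewrite -[x]reprK -pi_pglM mulg1. Qed.

Fact pgl_mulV : left_inverse pgl_one pgl_inv pgl_mul.
Proof. by move=> x; rewrite -[x]reprK -pi_pglV -pi_pglM mulVg. Qed.

Fact pgl_mulVr : right_inverse pgl_one pgl_inv pgl_mul.
Proof. by move=> x; rewrite -[x]reprK -pi_pglV -pi_pglM mulgV. Qed.

HB.instance Definition _ :=
  isGroup.Build PGL pgl_mulA pgl_mul1 pgl_mul1r pgl_mulV pgl_mulVr.

Definition mx_eval (f : {mpoly K[(n * n)%N]}) (A : 'M[K]_n) : K :=
  f.@[fun i => mxvec A 0 i].

Definition det_frac (f : {mpoly K[(n * n)%N]}) (d : nat) (A : GL) : K :=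
  mx_eval f (val A) / \det (val A) ^+ d.

Lemma det_frac_proper (f : {mpoly K[(n * n)%N]}) (d : nat) (A B : GL) :
  f \is (n * d)%N.-homog -> A = B %[mod PGL] -> det_frac f d A = det_frac f d B.
Proof.
move=> fh /pgl_eqP[c c0 eA].
rewrite /det_frac eA detZ exprMn -exprM.
suff -> : mx_eval f (c *: val B) = c ^+ (n * d) * mx_eval f (val B).
  by rewrite -mulf_div divff ?mul1r // expf_neq0.
rewrite /mx_eval !mevalE mulr_sumr; apply: eq_big_seq => m fm.
rewrite mulrCA; congr (_ * _); rewrite -(dhomogP _ _ _ fh m fm) /= mdegE.
rewrite -prodrXr -big_split /=; apply: eq_bigr => i _.
by rewrite linearZ mxE exprMn.
Qed.

(* K[PGL_n] is the algebra of invariants of the scalars in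
   K[GL_n] = K[x_ij, 1/det], that is, its part of degree 0. *)
Definition regular (F : PGL -> K) : Prop :=
  exists (d : nat) (f : {mpoly K[(n * n)%N]}),
    f \is (n * d)%N.-homog /\ forall A : GL, F (\pi_PGL A) = det_frac f d A.

Definition zero_locus (S : set (PGL -> K)) : set PGL :=
  [set x | forall F, S F -> F x = 0].

Definition zariski_open (U : set PGL) : Prop :=
  exists2 S : set (PGL -> K), S `<=` regular & U = ~` zero_locus S.

Lemma regular1 : regular (fun=> 1).
Proof.
exists 0%N, 1; split; first by rewrite muln0; apply: dhomog1.
by move=> A; rewrite /det_frac /mx_eval meval1 divr1.
Qed.

Lemma regularM F F' : regular F -> regular F' -> regular (fun x => F x * F' x).
Proof.
move=> [d [f [fh Ff]]] [e [g [gh Fg]]].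
exists (d + e)%N, (f * g); split; first by rewrite mulnDr; apply: dhomogM.
by move=> A; rewrite Ff Fg /det_frac /mx_eval mevalM exprD mulf_div.
Qed.

Fact zariski_openT : zariski_open setT.
Proof.
exists [set fun=> 1]; first by move=> _ ->; apply: regular1.
apply/esym; rewrite -subTset => x _ /(_ _ erefl) /eqP.
by rewrite oner_eq0.
Qed.

Fact zariski_openI : setI_closed zariski_open.
Proof.
move=> _ _ [S Sr ->] [T Tr ->].
exists [set H | exists F F', [/\ S F, T F' & H = fun x => F x * F' x]].
  by move=> _ [F [F' [/Sr Fr /Tr Fr' ->]]]; apply: regularM.
apply/seteqP; split=> x /=.
  move=> [/existsNP[F /not_implyP[SF Fx]] /existsNP[F' /not_implyP[TF Fx']]].
  move=> /(_ (fun x => F x * F' x)) /(_ _)/eqP.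
  rewrite mulf_eq0 => /(_ (ex_intro _ F (ex_intro _ F' _))).
  by case/(_ _)/orP=> // /eqP.
move=> /existsNP[_ /not_implyP[[F [F' [SF TF ->]]] /eqP]].
rewrite mulf_eq0 negb_or => /andP[/eqP Fx /eqP Fx'].
by split=> [/(_ _ SF)|/(_ _ TF)].
Qed.

Fact zariski_open_bigU (I : Type) (f : I -> set PGL) :
  (forall i, zariski_open (f i)) -> zariski_open (\bigcup_i f i).
Proof.
move=> fo.
exists [set F | exists i S, [/\ S `<=` regular, f i = ~` zero_locus S & S F]].
  by move=> F [i [S [Sr _ /Sr]]].
apply/seteqP; split=> x.
  move=> [i _]; have [S Sr fi] := fo i; rewrite fi => nx zx.
  by apply: nx => F SF; apply: zx; exists i, S.
move=> /existsNP[F /not_implyP[[i [S [Sr fi SF]]] Fx]].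
by exists i => //; rewrite fi => /(_ _ SF).
Qed.

HB.instance Definition _ := isOpenTopological.Build PGL
  zariski_openT zariski_openI zariski_open_bigU.

Lemma zariski_closedP (X : set PGL) :
  closed X <-> exists2 S : set (PGL -> K), S `<=` regular & X = zero_locus S.
Proof.
rewrite -openC; split=> [[S Sr e]|[S Sr ->]]; last by exists S.
by exists S => //; apply: setC_inj.
Qed.

Definition closed_subgroup (H : set PGL) : Prop := subgroup H /\ closed H.

Definition borel_subgroup (B : set PGL) : Prop :=
  [/\ closed_subgroup B, connected B, solvable_subgroup B &
      forall B' : set PGL, closed_subgroup B' -> connected B' ->
        solvable_subgroup B' -> B `<=` B' -> B' = B].

(* Equivalently, closed subgroups P such that the variety PGL_n / P is
   complete. *)
Definition parabolic_subgroup (P : set PGL) : Prop :=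
  closed_subgroup P /\ exists2 B, borel_subgroup B & B `<=` P.

Definition overgroup (H L : set PGL) : Prop := closed_subgroup L /\ H `<=` L.

Section Rationality.
Variables (k : fieldType) (iota : {rmorphism k -> K}).

Definition regular_over (F : PGL -> K) : Prop :=
  exists (d : nat) (f : {mpoly k[(n * n)%N]}),
    f \is (n * d)%N.-homog /\
    forall A : GL, F (\pi_PGL A) = det_frac (map_mpoly iota f) d A.

(* Stronger than being the zero locus of functions with coefficients in k: the
   vanishing ideal of X in K[PGL_n] must be spanned over K by its intersection
   with k[PGL_n]. *)
Definition defined_over (X : set PGL) : Prop :=
  closed X /\
  forall F : PGL -> K, regular F -> (forall x, X x -> F x = 0) ->
    exists (m : nat) (c : 'I_m -> K) (F_ : 'I_m -> PGL -> K),
      (forall i, regular_over (F_ i) /\ forall x, X x -> F_ i x = 0) /\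
      forall x, F x = \sum_(i < m) c i * F_ i x.

Definition irreducible_over (H : set PGL) : Prop :=
  forall P : set PGL, parabolic_subgroup P -> defined_over P ->
    P <> setT -> ~ H `<=` P.

End Rationality.
End Projective.

(* Main.v *)
(** Choose a in k which is not a square, so that T^4 - a is irreducible over k,
    and let b be its only root in K.  The group H is the image in PGL_4 of the
    units of K[N], where N is the companion matrix of T^4 - a; over k this is
    the multiplicative group of the field k(b).

    A parabolic subgroup P contains the group of invertible matrices which are
    triangular in some basis (Lie-Kolchin), and if P is proper then a corner
    entry in that basis vanishes on all of P.  If moreover P is defined over k,
    this linear form yields a nonzero matrix X over k with tr(X g) = 0 on P.
    When H is contained in P, the matrices N^i X have the same property, so for
    some fixed row y <> 0 we get y N^i X = 0 for all i.  As the only eigenline of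
    N is spanned by (b^3, b^2, b, 1), whose entries are independent over k, this
    forces X = 0.

    In a Jordan basis for N the matrices with constant diagonal which are lower
    triangular and satisfy x_10 + x_21 = al (x_21 + x_32) form an algebra
    containing N; its units give an overgroup of H for each al in K.  If it were
    defined over k, the algebra would be spanned by its matrices over k and
    would contain a nonzero singular one; being nilpotent, this matrix is killed
    by (b^3, b^2, b, 1), a contradiction as before. *)
Require Import Defs.
From HB Require Import structures.
From mathcomp Require Import all_boot all_order all_algebra.
From mathcomp Require Import mpoly ring.
From mathcomp Require Import boolp classical_sets cardinality topology.

Set Implicit Arguments.
Unset Strict Implicit.
Unset Printing Implicit Defensive.

Import GRing.Theory.
Local Open Scope ring_scope.
Local Open Scope classical_set_scope.
Local Open Scope quotient_scope.

(** * Polynomial functions and the Zariski topology *)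

Section PolynomialFunctions.
Variables (K : fieldType) (n : nat).
Implicit Types (f g : 'M[K]_n -> K) (A B : 'M[K]_n).

(** Only values on matrices matter below, so a function is recorded together with the degree of some
    homogeneous polynomial inducing it. *)
Definition hpoly (d : nat) f : Prop :=
  exists2 p : {mpoly K[(n * n)%N]}, p \is d.-homog & forall A, f A = mx_eval p A.

Lemma hpoly_ext d f g : f =1 g -> hpoly d f -> hpoly d g.
Proof. by move=> fg [p ph fp]; exists p => // A; rewrite -fg. Qed.

Lemma hpoly_const c : hpoly 0 (fun=> c).
Proof.
exists (c *: 1); first by apply/dhomogZ/dhomog1.
by move=> A; rewrite /mx_eval mevalZ meval1 mulr1.
Qed.

Lemma hpoly0 d : hpoly d (fun=> 0).
Proof. by exists 0; [exact: rpred0 | move=> A; rewrite /mx_eval meval0]. Qed.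

Lemma hpoly_entry i j : hpoly 1 (fun A => A i j).
Proof.
exists 'X_(mxvec_index i j); first by rewrite dhomogX /= mdeg1.
by move=> A; rewrite /mx_eval mevalXU mxvecE.
Qed.

Lemma hpolyD d f g : hpoly d f -> hpoly d g -> hpoly d (fun A => f A + g A).
Proof.
move=> [p ph fp] [q qh gq]; exists (p + q); first exact: dhomogD.
by move=> A; rewrite fp gq /mx_eval mevalD.
Qed.

Lemma hpolyM d e f g :
  hpoly d f -> hpoly e g -> hpoly (d + e) (fun A => f A * g A).
Proof.
move=> [p ph fp] [q qh gq]; exists (p * q); first exact: dhomogM.
by move=> A; rewrite fp gq /mx_eval mevalM.
Qed.

Lemma hpolyZ c d f : hpoly d f -> hpoly d (fun A => c * f A).
Proof. by move=> hf; rewrite -[d]add0n; apply: hpolyM hf; apply: hpoly_const. Qed.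

Lemma hpoly_sum I (s : seq I) (Q : pred I) d (F : I -> 'M[K]_n -> K) :
  (forall i, hpoly d (F i)) -> hpoly d (fun A => \sum_(i <- s | Q i) F i A).
Proof.
move=> hF; elim: s => [|i s IHs].
  by apply: hpoly_ext (hpoly0 d) => A; rewrite big_nil.
have [Qi|nQi] := boolP (Q i).
  by apply: hpoly_ext (hpolyD (hF i) IHs) => A; rewrite big_cons Qi.
by apply: hpoly_ext IHs => A; rewrite big_cons (negbTE nQi).
Qed.

Lemma hpoly_prod I (s : seq I) (e : I -> nat) (F : I -> 'M[K]_n -> K) :
  (forall i, hpoly (e i) (F i)) ->
  hpoly (\sum_(i <- s) e i)%N (fun A => \prod_(i <- s) F i A).
Proof.
move=> hF; elim: s => [|i s IHs].
  by rewrite big_nil; apply: hpoly_ext (hpoly_const 1) => A; rewrite big_nil.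
by rewrite big_cons; apply: hpoly_ext (hpolyM (hF i) IHs) => A; rewrite big_cons.
Qed.

Lemma hpolyX d e f : hpoly d f -> hpoly (d * e) (fun A => f A ^+ e).
Proof.
move=> hf; elim: e => [|e IHe].
  by rewrite muln0; apply: hpoly_ext (hpoly_const 1) => A; rewrite expr0.
by rewrite mulnS; apply: hpoly_ext (hpolyM hf IHe) => A; rewrite exprS.
Qed.

Definition hpoly_mx m p d (Phi : 'M[K]_n -> 'M[K]_(m, p)) : Prop :=
  forall i j, hpoly d (fun A => Phi A i j).

Lemma hpoly_det m d (Phi : 'M[K]_n -> 'M[K]_m) :
  hpoly_mx d Phi -> hpoly (m * d) (fun A => \det (Phi A)).
Proof.
move=> hPhi; rewrite /determinant; apply: hpoly_sum => s.
apply: hpolyZ; rewrite -[X in (X * d)%N](card_ord m) -sum_nat_const.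
by rewrite big_mkcond /=; apply: hpoly_prod => i.
Qed.

Lemma hpoly_mx_id : hpoly_mx 1 id.
Proof. by move=> i j; apply: hpoly_entry. Qed.

Lemma hpoly_mx_cst m p (B : 'M[K]_(m, p)) : hpoly_mx 0 (fun=> B).
Proof. by move=> i j; apply: hpoly_const. Qed.

Lemma hpoly_mulmx m p q d e
    (Phi : 'M[K]_n -> 'M[K]_(m, p)) (Psi : 'M[K]_n -> 'M[K]_(p, q)) :
  hpoly_mx d Phi -> hpoly_mx e Psi -> hpoly_mx (d + e) (fun A => Phi A *m Psi A).
Proof.
move=> hPhi hPsi i j.
have h : hpoly (d + e) (fun A => \sum_l Phi A i l * Psi A l j).
  by apply: hpoly_sum => l; apply: hpolyM.
by apply: hpoly_ext h => A; rewrite mxE.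
Qed.

Lemma hpoly_adj : hpoly_mx n.-1 (fun A => \adj A).
Proof.
move=> i j.
have h : hpoly (n.-1 * 1) (fun A => \det (row' j (col' i A))).
  apply: hpoly_det => p q; apply: hpoly_ext (hpoly_entry (lift j p) (lift i q)).
  by move=> A; rewrite !mxE.
rewrite muln1 in h; apply: hpoly_ext (hpolyZ ((-1) ^+ (j + i)) h) => A.
by rewrite mxE.
Qed.

Lemma hpoly_comp d e f (Phi : 'M[K]_n -> 'M[K]_n) :
  hpoly d f -> hpoly_mx e Phi -> hpoly (d * e) (fun A => f (Phi A)).
Proof.
move=> [p ph fp] hPhi.
have h : hpoly (d * e) (fun A => \sum_(m <- msupp p | m \in msupp p)
    p@_m * \prod_i (mxvec (Phi A) 0 i) ^+ m i).
  apply: hpoly_sum => m.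
  have [/(dhomogP _ _ _ ph) /= <-|] := boolP (m \in msupp p).
    apply: hpolyZ; rewrite mdegE big_distrl /=.
    apply: hpoly_prod => i; rewrite mulnC; apply: hpolyX.
    case/mxvec_indexP: i => i j.
    by apply: hpoly_ext (hPhi i j) => A; rewrite mxvecE.
  (* [hpoly_sum] asks for the degree of every summand, so a monomial outside the support is treated
     as the zero function. *)
  move=> mp; apply: hpoly_ext (hpoly0 _) => A.
  by rewrite memN_msupp_eq0 // mul0r.
apply: hpoly_ext h => A.
by rewrite fp /mx_eval mevalE -big_seq.
Qed.

(** Homogeneity is lost on an affine line, but a nonzero polynomial in one variable has finitely
    many roots; the density arguments below rest on this. *)
Lemma hpoly_line d f A B :
  hpoly d f -> exists p : {poly K}, forall t, f (A + t *: B) = p.[t].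
Proof.
move=> [p _ fp].
exists (\sum_(m <- msupp p) p@_m *:
  \prod_i ((mxvec A 0 i)%:P + mxvec B 0 i *: 'X) ^+ m i).
move=> t; rewrite fp /mx_eval mevalE horner_sum; apply: eq_bigr => m _.
rewrite hornerZ horner_prod; congr (_ * _); apply: eq_bigr => i _.
by rewrite !hornerE linearD linearZ !mxE mulrC.
Qed.

End PolynomialFunctions.

(** * Regular functions as fractions of degree zero *)

Section RegularFunctions.
Variables (K : fieldType) (n : nat).
Local Notation GL := (GL K n).
Local Notation PGL := (PGL K n).
Implicit Types (f : 'M[K]_n -> K) (F : PGL -> K) (g h : GL) (x y : PGL).

Definition mkGL (X : 'M[K]_n) (Xu : X \in unitmx) : GL :=
  exist (fun X : 'M[K]_n => X \in unitmx) X Xu.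

Lemma val_glM g h : val (g * h)%g = val g *m val h.
Proof. by []. Qed.

Lemma val_gl1 : val (1%g : GL) = 1%:M.
Proof. by []. Qed.

Lemma pgl_piM g h : \pi_PGL (g * h)%g = (\pi_PGL g * \pi_PGL h)%g.
Proof. exact: pi_pglM. Qed.

Lemma pgl_piV g : \pi_PGL (g^-1)%g = ((\pi_PGL g)^-1)%g.
Proof. exact: pi_pglV. Qed.

Lemma pgl_pi1 : \pi_PGL 1%g = 1%g.
Proof. by []. Qed.

Lemma gl_det_neq0 g : \det (val g) != 0.
Proof. by have := valP g; rewrite unitmxE unitfE. Qed.

(** The value is read off at the representative picked by [repr]; by [frac_pi] any other would do
    when the numerator has degree [n * d]. *)
Definition frac d f : PGL -> K :=
  fun x => f (val (repr x)) / \det (val (repr x)) ^+ d.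

Lemma frac_pi d f g : hpoly (n * d) f ->
  frac d f (\pi_PGL g) = f (val g) / \det (val g) ^+ d.
Proof.
move=> [p ph fp]; rewrite /frac !fp.
by apply: (det_frac_proper ph); rewrite reprK.
Qed.

Lemma regular_frac d f : hpoly (n * d) f -> regular (frac d f).
Proof.
move=> hf; have [p ph fp] := hf; exists d, p; split=> // A.
by rewrite frac_pi // fp.
Qed.

Lemma regularP F : regular F <-> exists d f, hpoly (n * d) f /\
  forall g, F (\pi_PGL g) = f (val g) / \det (val g) ^+ d.
Proof.
split=> [[d [p [ph Fp]]]|[d [f [[p ph fp] Ff]]]].
  by exists d, (mx_eval p); split=> //; exists p.
by exists d, p; split=> // g; rewrite Ff fp.
Qed.

Lemma pglP x : exists g, x = \pi_PGL g.
Proof. by exists (repr x); rewrite reprK. Qed.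

Lemma regularD F F' : regular F -> regular F' -> regular (fun x => F x + F' x).
Proof.
move=> /regularP[d [f [hf Ff]]] /regularP[e [f' [hf' Ff']]].
have hdet := hpoly_det (@hpoly_mx_id K n).
rewrite muln1 in hdet.
apply/regularP; exists (d + e)%N,
  (fun A => f A * \det A ^+ e + f' A * \det A ^+ d); split=> [|g].
  apply: hpolyD.
    by rewrite mulnDr; apply: hpolyM => //; apply: hpolyX.
  by rewrite addnC mulnDr; apply: hpolyM => //; apply: hpolyX.
by rewrite Ff Ff' exprD addf_div ?expf_neq0 ?gl_det_neq0.
Qed.

Lemma regularZ c F : regular F -> regular (fun x => c * F x).
Proof.
move=> /regularP[d [f [hf Ff]]]; apply/regularP.
exists d, (fun A => c * f A); split=> [|g]; first exact: hpolyZ.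
by rewrite Ff mulrA.
Qed.

Lemma regular_sum I (s : seq I) (F : I -> PGL -> K) :
  (forall i, regular (F i)) -> regular (fun x => \sum_(i <- s) F i x).
Proof.
move=> hF; elim: s => [|i s IHs].
  have /regularZ -/(_ 0) := @regular1 K n; congr regular.
  by apply/funext => x; rewrite mul0r big_nil.
have := regularD (hF i) IHs; congr regular.
by apply/funext => x; rewrite big_cons.
Qed.

(* The entries of [Phi] have degree [q] and [\det (Phi A)] is
   [c * \det A ^+ q], so that the quotients of degree 0 pull back to
   quotients of degree 0. *)
Lemma continuous_hpoly (phi : PGL -> PGL) (Phi : 'M[K]_n -> 'M[K]_n) q c :
  hpoly_mx q Phi -> c != 0 ->
  (forall g, \det (Phi (val g)) = c * \det (val g) ^+ q) ->
  (forall g, exists2 h, phi (\pi_PGL g) = \pi_PGL h & val h = Phi (val g)) ->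
  continuous phi.
Proof.
move=> hPhi c0 detPhi phiPhi; apply/continuous_closedP => X.
move=> /zariski_closedP[S Sreg ->]; apply/zariski_closedP.
exists [set F | exists2 F', S F' & F = F' \o phi]; last first.
  apply/seteqP; split=> x /= Zx; first by move=> _ [F' SF' ->]; exact: Zx.
  by move=> F SF; apply: (Zx (F \o phi)); exists F.
move=> _ [F /Sreg/regularP[d [f [hf Ff]]] ->].
apply/regularP; exists (d * q)%N, (fun A => c^-1 ^+ d * f (Phi A)).
split=> [|g /=]; first by rewrite mulnA; apply/hpolyZ/hpoly_comp.
have [h -> vh] := phiPhi g.
by rewrite Ff vh detPhi exprMn invfM exprVn -exprM (mulnC q) mulrCA mulrA.
Qed.

End RegularFunctions.

Section LinearlyClosed.
Variables (K : fieldType) (V : lmodType K).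
Implicit Type A : set V.

Definition lin_closed A : Prop :=
  A 0 /\ forall c X Y, A X -> A Y -> A (c *: X + Y).

Lemma lin_closedZ A c X : lin_closed A -> A X -> A (c *: X).
Proof. by move=> [A0 AD] AX; rewrite -[_ *: _]addr0; apply: AD. Qed.

Lemma lin_closedD A X Y : lin_closed A -> A X -> A Y -> A (X + Y).
Proof. by move=> [A0 AD] AX AY; rewrite -[X]scale1r; apply: AD. Qed.

Lemma lin_closedB A X Y : lin_closed A -> A X -> A Y -> A (X - Y).
Proof. by move=> [A0 AD] AX AY; rewrite addrC -scaleN1r; apply: AD. Qed.

Lemma lin_closed_sum A I (s : seq I) (F : I -> V) :
  lin_closed A -> (forall i, A (F i)) -> A (\sum_(i <- s) F i).
Proof.
by move=> linA AF; elim/big_rec: _ => [|i X _]; [case: linA | apply: lin_closedD].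
Qed.

End LinearlyClosed.

(** * Units of matrix algebras modulo scalars *)

Section MatrixAlgebras.
Variables (K : fieldType) (n : nat).
Local Notation GL := (GL K n.+1).
Local Notation PGL := (PGL K n.+1).
Implicit Types (A : set 'M[K]_n.+1) (S : set 'M[K]_n.+1) (g h : GL) (x y : PGL).

Definition subalgebra A : Prop :=
  [/\ lin_closed A, A 1%:M & forall X Y, A X -> A Y -> A (X *m Y)].

(** The annihilator for the trace form. Closed sets of the projective group arise below by writing a
    linear space in this shape. *)
Definition ann S : set 'M[K]_n.+1 := [set X | forall Y, S Y -> \tr (Y *m X) = 0].

Definition pset A : set PGL := [set x | A (val (repr x))].

Lemma subalgebraX A X m : subalgebra A -> A X -> A (X ^+ m).
Proof.
case=> linA A1 AM AX; elim: m => [|m IHm]; first by rewrite expr0.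
by rewrite exprS; apply: AM.
Qed.

Lemma subalgebra_horner A X p : subalgebra A -> A X -> A (horner_mx X p).
Proof.
move=> subA AX; have [linA A1 AM] := subA.
elim/poly_ind: p => [|p c IHp]; first by rewrite rmorph0; case: linA.
rewrite rmorphD rmorphM /= horner_mx_X horner_mx_C.
apply: lin_closedD => //; first exact: AM.
by rewrite -scalemx1; apply: lin_closedZ.
Qed.

(** By Cayley-Hamilton the inverse is a polynomial in [X]: the constant term of the characteristic
    polynomial is nonzero, as 0 is not an eigenvalue. *)
Lemma subalgebra_invmx A X : subalgebra A -> X \in unitmx -> A X -> A (invmx X).
Proof.
move=> subA Xu AX; have [linA A1 AM] := subA.
set p := char_poly X; set c := p.[0].
have c0 : c != 0.
  apply: contraTneq Xu => pc; have : eigenvalue X 0.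
    by rewrite eigenvalue_root_char; apply/eqP.
  case/eigenvalueP=> v; rewrite scale0r => vX v0; apply: contra v0 => Xu.
  by rewrite -[v]mulmx1 -(mulmxV Xu) mulmxA vX mul0mx.
have /factor_theorem[q pq] : root (p - c%:P) 0.
  by rewrite /root !hornerE subrr.
have := congr1 (horner_mx X) pq.
rewrite subr0 rmorphB rmorphM /= Cayley_Hamilton horner_mx_X horner_mx_C.
move=> /(congr1 (mulmx^~ (invmx X))).
rewrite mulmxK // mulmxBl mul0mx sub0r mul_scalar_mx => /(congr1 -%R).
rewrite opprK => /(congr1 ( *:%R c^-1)); rewrite scalerA mulVf // scale1r => ->.
apply: lin_closedZ => //; rewrite -scaleN1r; apply: lin_closedZ => //.
exact: subalgebra_horner.
Qed.

Lemma ann_lin S : lin_closed (ann S).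
Proof.
split=> [Y _|c X Y SX SY Z SZ]; first by rewrite mulmx0 mxtrace0.
by rewrite mulmxDr -scalemxAr mxtraceD mxtraceZ SX ?SY // mulr0 addr0.
Qed.

Lemma pset_pi A g : lin_closed A -> pset A (\pi_PGL g) <-> A (val g).
Proof.
move=> linA; rewrite /pset /=.
have [g' /esym/pgl_eqP[c c0 eg]] := piP PGL g.
split=> [|Ag]; last by rewrite eg; apply: lin_closedZ.
rewrite eg => /(lin_closedZ c^-1 linA).
by rewrite scalerA mulVf // scale1r.
Qed.

Lemma pset_subgroup A : subalgebra A -> subgroup (pset A).
Proof.
move=> subA; have [linA A1 AM] := subA; split.
  by rewrite -pgl_pi1; apply/pset_pi.
move=> x y; have [g ->] := pglP x; have [h ->] := pglP y.
move=> /(pset_pi g linA) Ag /(pset_pi h linA) Ah.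
rewrite -pgl_piV -pgl_piM; apply/pset_pi => //=; apply: AM => //.
by apply: subalgebra_invmx => //; exact: valP.
Qed.

Lemma gl_entry_neq0 g : exists i j, val g i j != 0.
Proof.
apply: contrapT => g0; have := gl_det_neq0 g.
have -> : val g = 0.
  apply/matrixP => i j; rewrite mxE; apply: contrapT => /eqP gij.
  by apply: g0; exists i, j.
by rewrite det0 eqxx.
Qed.

Lemma hpoly_form Y : hpoly 1 (fun X : 'M[K]_n.+1 => \tr (Y *m X)).
Proof.
rewrite /mxtrace; apply: hpoly_sum => i.
by rewrite -[1%N]add0n; apply: (hpoly_mulmx (hpoly_mx_cst _ Y) (@hpoly_mx_id K n.+1)).
Qed.

(* A linear form times a power of an entry has degree [n.+1], and dividing it
   by the determinant makes it a function on the projective group. *)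
Definition form_entry (Y : 'M[K]_n.+1) i j : 'M[K]_n.+1 -> K :=
  fun X => \tr (Y *m X) * X i j ^+ n.

Lemma hpoly_form_entry Y i j : hpoly (n.+1 * 1) (form_entry Y i j).
Proof.
have -> : (n.+1 * 1 = 1 + 1 * n)%N by rewrite mul1n muln1.
exact: hpolyM (hpoly_form Y) (hpolyX n (hpoly_entry K i j)).
Qed.

Lemma frac_form_entry Y i j g :
  frac 1 (form_entry Y i j) (\pi_PGL g) =
  \tr (Y *m val g) * val g i j ^+ n / \det (val g).
Proof. by rewrite frac_pi ?expr1 //; apply: hpoly_form_entry. Qed.

(** Each form is multiplied by powers of all entries in turn. An invertible matrix has a nonzero
    entry, so the products have no common zeros beyond those of the forms. *)
Lemma pset_ann_closed S : closed (pset (ann S)).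
Proof.
apply/zariski_closedP.
exists [set F | exists Y i j, S Y /\ F = frac 1 (form_entry Y i j)].
  by move=> _ [Y [i [j [_ ->]]]]; apply/regular_frac/hpoly_form_entry.
apply/seteqP; split=> x; have [g ->] := pglP x.
  move=> /(pset_pi g (ann_lin S)) Sg _ [Y [i [j [SY ->]]]].
  by rewrite frac_form_entry Sg // !mul0r.
move=> Zg; apply/pset_pi; first exact: ann_lin.
move=> Y SY; have [i [j gij]] := gl_entry_neq0 g.
have /eqP := Zg _ (ex_intro _ Y (ex_intro _ i (ex_intro _ j (conj SY erefl)))).
rewrite frac_form_entry !mulf_eq0 invr_eq0 (negbTE (gl_det_neq0 g)) orbF.
by rewrite expf_eq0 (negbTE gij) andbF orbF => /eqP.
Qed.

End MatrixAlgebras.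

(** * Connectedness of groups of units *)

Section Connectedness.
Variables (K : fieldType) (n : nat).
Hypothesis Kinf : infinite_set [set: K].
Local Notation GL := (GL K n.+1).
Local Notation PGL := (PGL K n.+1).
Implicit Types (A : set 'M[K]_n.+1) (g h : GL) (x y : PGL).

Lemma infinite_uniq_seq m : exists2 s : seq K, uniq s & size s = m.
Proof.
elim: m => [|m [s us sm]]; first by exists [::].
have [z zs] : exists z, z \notin s.
  apply: contrapT => nx; apply: Kinf; apply: (sub_finite_set _ (finite_seq s)).
  by move=> z _ /=; apply: contrapT => /negP zs; apply: nx; exists z.
by exists (z :: s); rewrite /= ?zs ?sm.
Qed.

Lemma poly_nonroot (p : {poly K}) : p != 0 -> exists t, p.[t] != 0.
Proof.
move=> p0; have [s us sp] := infinite_uniq_seq (size p).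
apply: contrapT => npt; have rs : all (root p) s.
  apply/allP => t _; rewrite rootE; apply: contrapT => /negP pt.
  by apply: npt; exists t.
by have := max_poly_roots p0 rs us; rewrite sp ltnn.
Qed.

(* Two points of the algebra are joined by a line, on which the units form an
   irreducible curve. *)
Lemma pset_connected A : lin_closed A -> connected (pset A).
Proof.
move=> linA B [x Bx] [C1 C1o BC1] [C2 /zariski_closedP[S2 S2r C2E] BC2].
have [S1 S1r C1E] : exists2 S, S `<=` @regular K n.+1 & C1 = ~` zero_locus S.
  exact: C1o.
apply/seteqP; split=> [y|y Ay]; first by rewrite BC1 => -[].
apply: contrapT => nBy.
have [Ax [F1 [S1F F1x]]] : pset A x /\ exists F, S1 F /\ F x <> 0.
  have := Bx; rewrite BC1 C1E => -[Ax] /existsNP[F /not_implyP[SF Fx]].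
  by split=> //; exists F.
have [F2 [S2F F2y]] : exists F, S2 F /\ F y <> 0.
  apply: contrapT => nF; apply: nBy; rewrite BC2 C2E; split=> // F SF.
  by apply: contrapT => Fy; apply: nF; exists F.
have [d1 [f1 [hf1 Ff1]]] := (regularP F1).1 (S1r _ S1F).
have [d2 [f2 [hf2 Ff2]]] := (regularP F2).1 (S2r _ S2F).
have [g gx] := pglP x; have [h hy] := pglP y.
have [p1 p1E] := hpoly_line (val g) (val h - val g) hf1.
have [p2 p2E] := hpoly_line (val g) (val h - val g) hf2.
have [p3 p3E] := hpoly_line (val g) (val h - val g) (hpoly_det (@hpoly_mx_id K n.+1)).
have at0 : val g + 0 *: (val h - val g) = val g by rewrite scale0r addr0.
have at1 : val g + 1 *: (val h - val g) = val h by rewrite scale1r addrC subrK.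
(* Along the line, [p1] and [p2] are the numerators of [F1] and [F2], and [p3] is the determinant.
   At a point where none vanishes, the open description puts the point in [B] and the closed one
   excludes it. *)
have [t] : exists t, (p1 * p2 * p3).[t] != 0.
  apply: poly_nonroot; rewrite !mulf_neq0 //; apply/eqP => p0.
  - by apply: F1x; rewrite gx Ff1 -at0 p1E p0 horner0 mul0r.
  - by apply: F2y; rewrite hy Ff2 -at1 p2E p0 horner0 mul0r.
  - by have := gl_det_neq0 g; rewrite -at0 p3E p0 horner0 eqxx.
rewrite !hornerM !mulf_eq0 !negb_or -p1E -p2E -p3E => /andP[/andP[q1 q2] q3].
have Wu : val g + t *: (val h - val g) \in unitmx by rewrite unitmxE unitfE.
pose w := mkGL Wu.
have Aw : pset A (\pi_PGL w).
  apply/pset_pi => //=; rewrite gx in Ax; rewrite hy in Ay.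
  move/(pset_pi _ linA): Ax => Ag; move/(pset_pi _ linA): Ay => Ah.
  by rewrite addrC; case: (linA) => _; apply=> //; apply: lin_closedB.
have Bw : B (\pi_PGL w).
  rewrite BC1 C1E; split=> // /(_ _ S1F)/eqP.
  by rewrite Ff1 mulf_eq0 invr_eq0 expf_eq0 (negbTE (gl_det_neq0 w)) andbF orbF (negbTE q1).
move: Bw; rewrite BC2 C2E => -[_ /(_ _ S2F)/eqP].
by rewrite Ff2 mulf_eq0 invr_eq0 expf_eq0 (negbTE (gl_det_neq0 w)) andbF orbF (negbTE q2).
Qed.

End Connectedness.

(** * Derived subgroups of abstract groups *)

Section AbstractSubgroups.
Local Open Scope group_scope.
Variable G : groupType.
Implicit Types (H : set G).

Lemma subgroup1 H : subgroup H -> H 1. Proof. by case. Qed.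

Lemma subgroupV H x : subgroup H -> H x -> H x^-1.
Proof. by move=> [H1 HV] Hx; rewrite -[x^-1]mul1g; apply: HV. Qed.

Lemma subgroupM H x y : subgroup H -> H x -> H y -> H (x * y).
Proof.
by move=> sH Hx Hy; rewrite -[y]invgK; apply: (sH.2) => //; apply: subgroupV.
Qed.

Lemma subgroupR H x y : subgroup H -> H x -> H y -> H [~ x, y].
Proof.
move=> sH Hx Hy; apply: subgroupM => //; first exact: subgroupV.
apply: subgroupM => //; first exact: subgroupV.
exact: subgroupM.
Qed.

Lemma derived_subgroup_subgroup H : subgroup (derived_subgroup H).
Proof.
split=> [D [sD _]|x y Dx Dy D [sD RD]]; first exact: subgroup1.
by apply: sD.2; [apply: Dx | apply: Dy].
Qed.

Lemma derived_subgroupR H x y : H x -> H y -> derived_subgroup H [~ x, y].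
Proof. by move=> Hx Hy D [_ RD]; apply: RD; exists x, y. Qed.

Lemma derived_subgroup_min H D : subgroup D ->
  (forall x y, H x -> H y -> D [~ x, y]) -> derived_subgroup H `<=` D.
Proof. by move=> sD RD x; apply; split=> // _ [y [z [Hy Hz ->]]]; apply: RD. Qed.

Lemma derived_subgroup_sub H : subgroup H -> derived_subgroup H `<=` H.
Proof. by move=> sH; apply: derived_subgroup_min => // x y; apply: subgroupR. Qed.

(** The conjugate is [y] times the commutator of [y] and [x^-1]. *)
Lemma derived_subgroupJ H x y : subgroup H ->
  H x -> derived_subgroup H y -> derived_subgroup H (x * y * x^-1).
Proof.
move=> sH Hx Dy; have Hy := derived_subgroup_sub sH Dy.
have sD := derived_subgroup_subgroup H.
have := subgroupM sD Dy (derived_subgroupR Hy (subgroupV sH Hx)).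
by rewrite /commg /conjg invgK !mulgA mulgV mul1g.
Qed.

End AbstractSubgroups.

(** * Connectedness of derived subgroups *)

Section ConnectedDerived.
Variables (K : fieldType) (n : nat).
Local Notation GL := (GL K n.+1).
Local Notation PGL := (PGL K n.+1).
Implicit Types (g h : GL) (x y : PGL) (G : set PGL).

Lemma adj_gl g : \adj (val g) = \det (val g) *: invmx (val g).
Proof.
by rewrite /invmx (valP g) scalerA mulfV ?scale1r ?gl_det_neq0.
Qed.

Lemma det_adj_gl g : \det (\adj (val g)) = \det (val g) ^+ n.
Proof.
apply: (mulfI (gl_det_neq0 g)).
by rewrite -det_mulmx mul_mx_adj det_scalar -exprS.
Qed.

Lemma scale_gl_subproof c g : c != 0 -> c *: val g \in unitmx.
Proof. by move=> c0; rewrite unitmxZ ?unitfE //; exact: valP. Qed.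

Lemma pi_scale c g (c0 : c != 0) :
  \pi_PGL (mkGL (scale_gl_subproof g c0)) = \pi_PGL g.
Proof. by apply/pgl_eqP; exists c. Qed.

(** The adjugate replaces the inverse: it is polynomial and differs from it by the determinant, a
    scalar which the projective group does not see. *)
Lemma continuous_divg x : continuous (fun y => (x * y^-1)%g).
Proof.
have [a ->] := pglP x.
apply: (@continuous_hpoly _ _ _ (fun A => val a *m \adj A) n (\det (val a))).
- by rewrite -[n in hpoly_mx n]add0n; apply: hpoly_mulmx (hpoly_mx_cst _ _) (@hpoly_adj _ _).
- exact: gl_det_neq0.
- by move=> g; rewrite det_mulmx det_adj_gl.
move=> g; exists (mkGL (scale_gl_subproof (a * g^-1)%g (gl_det_neq0 g))).
  by rewrite pi_scale -pgl_piV -pgl_piM.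
by rewrite /= adj_gl scalemxAr.
Qed.

Lemma continuous_commg x : continuous (fun y => [~ x, y]%g).
Proof.
have [a ->] := pglP x.
apply: (@continuous_hpoly _ _ _
  (fun A => invmx (val a) *m (\adj A *m (val a *m A))) (0 + (n + (0 + 1))) 1).
- apply: hpoly_mulmx (hpoly_mx_cst _ _) _; apply: hpoly_mulmx (@hpoly_adj _ _) _.
  by apply: hpoly_mulmx (hpoly_mx_cst _ _) _; apply: hpoly_mx_id.
- exact: oner_neq0.
- move=> g; rewrite !det_mulmx det_adj_gl det_inv mul1r !add0n addn1 exprSr.
  by rewrite mulrCA mulKf ?gl_det_neq0.
move=> g; exists (mkGL (scale_gl_subproof [~ a, g]%g (gl_det_neq0 g))).
  by rewrite pi_scale /commg /conjg !(pgl_piM, pgl_piV).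
by rewrite /= adj_gl -scalemxAl -scalemxAr.
Qed.

Lemma connected_image (phi : PGL -> PGL) G :
  continuous phi -> connected G -> connected (phi @` G).
Proof.
move=> cphi cG; apply: connected_continuous_connected => //.
by apply: continuous_subspaceT => x.
Qed.

Lemma derived_connected G :
  subgroup G -> connected G -> connected (derived_subgroup G).
Proof.
move=> sG cG.
(* The points joined to 1 by a connected part of the derived subgroup form a subgroup containing all
   commutators. *)
pose D := [set x | exists C, [/\ connected C, C `<=` derived_subgroup G, C 1%g & C x]].
have sD := derived_subgroup_subgroup G.
have subD : derived_subgroup G `<=` D.
  apply: derived_subgroup_min.
    split=> [|x y [Cx [cCx sCx Cx1 Cxx]] [Cy [cCy sCy Cy1 Cyy]]].
      exists [set 1%g]; split=> //; first exact: connected1.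
      by move=> _ ->; apply: subgroup1.
    (* The two pieces are connected and meet at [x]. *)
    exists (Cx `|` (fun z => (x * z^-1)%g) @` Cy); split.
    - apply: connectedU => //; last by apply: connected_image => //; apply: continuous_divg.
      by exists x; split=> //; exists 1%g; rewrite ?invg1 ?mulg1.
    - move=> _ [/sCx//|[z Cyz <-]]; apply: sD.2; [exact: sCx | exact: sCy].
    - by left.
    - by right; exists y.
  move=> x y Gx Gy; exists ((fun z => [~ x, z]%g) @` G); split.
  - by apply: connected_image => //; apply: continuous_commg.
  - by move=> _ [z Gz <-]; apply: derived_subgroupR.
  - exists 1%g; first exact: subgroup1.
    by rewrite commg1.
  - by exists y.
have -> : derived_subgroup G = \bigcup_(C in [set C |
    [/\ connected C, C `<=` derived_subgroup G & C 1%g]]) C.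
  apply/seteqP; split=> [x /subD[C [cC sC C1 Cx]]|x [C [cC sC C1] Cx]].
    by exists C.
  exact: sC.
apply: bigcup_connected; last by move=> C [].
by exists 1%g => C [].
Qed.

End ConnectedDerived.

(** * The Lie-Kolchin theorem and Borel subgroups *)

Section LieKolchin.
Variables (K : closedFieldType) (n : nat).
Local Notation GL := (GL K n.+1).
Local Notation PGL := (PGL K n.+1).
Implicit Types (g h : GL) (x y : PGL) (G : set PGL) (U W : set 'rV[K]_n.+1).
Implicit Types (X : 'M[K]_n.+1) (v w : 'rV[K]_n.+1).

Definition stable G W : Prop :=
  forall g, G (\pi_PGL g) -> forall v, W v -> W (v *m val g).

Definition rowspace r (Q : 'M[K]_(r, n.+1)) : set 'rV[K]_n.+1 :=
  [set v | (v <= Q)%MS].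

Lemma rowspace_lin r (Q : 'M[K]_(r, n.+1)) : lin_closed (rowspace Q).
Proof.
split=> [|c v w Qv Qw]; first exact: sub0mx.
by apply: addmx_sub => //; apply: scalemx_sub.
Qed.

Lemma lin_closed_rowspace W : lin_closed W -> exists Q : 'M_n.+1, W = rowspace Q.
Proof.
move=> linW.
(* A row space of largest rank inside [W] is all of [W]: a missing vector would raise the rank. *)
pose P r := `[< exists2 Q : 'M[K]_n.+1, rowspace Q `<=` W & \rank Q = r >].
have P0 : exists r, P r.
  exists 0%N; apply/asboolP; exists 0; last by rewrite mxrank0.
  by move=> v; rewrite /rowspace /= submx0 => /eqP ->; case: linW.
have Pub r : P r -> (r <= n.+1)%N by move=> /asboolP[Q _ <-]; apply: rank_leq_row.
case: (ex_maxnP P0 Pub) => r /asboolP[Q QW rQ] rmax.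
exists Q; apply/seteqP; split=> // v Wv; apply: contrapT => /negP nQv.
have QvW : rowspace (Q + v)%MS `<=` W.
  move=> w /sub_addsmxP[[u1 u2] /= ->]; apply: lin_closedD => //.
    by apply: QW; apply: submxMl.
  by rewrite [u2]mx11_scalar mul_scalar_mx; apply: lin_closedZ.
have /rmax : P (\rank (Q + v)%MS) by apply/asboolP; exists (Q + v)%MS.
apply/negP; rewrite -ltnNge -rQ; have /ltn_leqif -> := mxrank_leqif_sup (addsmxSl Q v).
by apply: contra nQv; apply/submx_trans/addsmxSr.
Qed.

(** This gives an irreducible step above [U], found as a stable space of least rank; Schur-type
    arguments apply to it. *)
Lemma minimal_stable G U W :
  lin_closed W -> stable G W -> U `<=` W -> (exists2 v, W v & ~ U v) ->
  exists W0, [/\ lin_closed W0, stable G W0, U `<=` W0 & W0 `<=` W] /\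
    [/\ (exists2 v, W0 v & ~ U v) &
      forall V, lin_closed V -> stable G V -> U `<=` V -> (exists2 v, V v & ~ U v) ->
      V `<=` W0 -> W0 `<=` V].
Proof.
move=> linW stW UW nU.
pose P r := `[< exists Q : 'M[K]_n.+1, \rank Q = r /\
  [/\ stable G (rowspace Q), U `<=` rowspace Q, rowspace Q `<=` W &
      exists2 v, rowspace Q v & ~ U v] >].
have P0 : exists r, P r.
  have [Q WQ] := lin_closed_rowspace linW.
  by exists (\rank Q); apply/asboolP; exists Q; rewrite -WQ; split=> //; split.
case: (ex_minnP P0) => r /asboolP[Q [rQ [stQ UQ QW nUQ]]] rmin.
exists (rowspace Q); split; first by split=> //; apply: rowspace_lin.
split=> // V linV stV UV nUV.
have [Q' VQ'] := lin_closed_rowspace linV; rewrite VQ' in stV UV nUV *.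
move=> QQ' v Qv.
have sQQ' : (Q' <= Q)%MS.
  by apply/row_subP => i; apply: QQ'; apply: row_sub.
have /rmin : P (\rank Q').
  by apply/asboolP; exists Q'; split=> //; split=> // w /QQ'/QW.
rewrite -rQ (geq_leqif (mxrank_leqif_sup sQQ')) => sQ'Q.
exact: submx_trans sQ'Q.
Qed.

(** * Eigenvectors modulo a row space *)

Section Modulo.
Variables (r : nat) (Q : 'M[K]_(r, n.+1)).
Local Notation U := (rowspace Q).

(** The characteristic polynomial kills [w]. When its linear factors are applied one by one, the
    last vector before [U] is entered is an eigenvector modulo [U]. *)
Lemma eigenvector_mod W X w :
  lin_closed W -> (forall v, W v -> W (v *m X)) -> W w -> ~ U w ->
  exists v mu, [/\ W v, ~ U v & U (v *m X - mu *: v)].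
Proof.
move=> linW WX; have [s Es] := closed_field_poly_normal (char_poly X).
have : U (w *m horner_mx X (\prod_(z <- s) ('X - z%:P))).
  have : horner_mx X (char_poly X) = 0 by apply: Cayley_Hamilton.
  rewrite Es (monicP (char_poly_monic X)) scale1r => ->.
  by rewrite mulmx0; apply: sub0mx.
elim: s w {Es} => [|z s IHs] w; first by rewrite big_nil rmorph1 mulmx1.
rewrite big_cons rmorphM rmorphB /= horner_mx_X horner_mx_C mulmxA => Uw Ww nUw.
have Wz : W (w *m (X - z%:M)).
  rewrite mulmxBr mul_mx_scalar; apply: lin_closedB => //; first exact: WX.
  exact: lin_closedZ.
have [Uz|nUz] := pselect (U (w *m (X - z%:M))); last exact: IHs nUz.
by exists w, z; split=> //; rewrite mulmxBr mul_mx_scalar in Uz.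
Qed.

(** Modulo [U], a polynomial in [X] multiplies an eigenvector by its value at [mu]; Cayley-Hamilton
    then makes [mu] a root of the characteristic polynomial. *)
Lemma eigenvalues_mod X : (forall v, U v -> U (v *m X)) ->
  exists s : seq K, forall v mu, ~ U v -> U (v *m X - mu *: v) -> mu \in s.
Proof.
move=> UX; have [s Es] := closed_field_poly_normal (char_poly X).
exists s => v mu nUv Uv.
have key t : U (v *m horner_mx X (\prod_(z <- t) ('X - z%:P))
    - (\prod_(z <- t) (mu - z)) *: v).
  elim: t => [|z t IHt].
    by rewrite !big_nil rmorph1 mulmx1 scale1r subrr; apply: sub0mx.
  rewrite !big_cons mulrC rmorphM rmorphB /= horner_mx_X horner_mx_C mulmxA.
  set p := \prod_(j <- t) _ in IHt *; set c := \prod_(j <- t) _ in IHt *.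
  set q := v *m horner_mx X p in IHt *.
  have -> : q *m (X - z%:M) - ((mu - z) * c) *: v =
     ((q - c *: v) *m X - z *: (q - c *: v)) + c *: (v *m X - mu *: v).
    rewrite mulmxBr mul_mx_scalar mulmxBl -scalemxAl.
    by apply/rowP => j; rewrite !mxE; ring.
  apply: lin_closedD (rowspace_lin Q) _ _; last exact: lin_closedZ (rowspace_lin Q) _.
  apply: lin_closedB (rowspace_lin Q) _ _; first exact: UX.
  exact: lin_closedZ (rowspace_lin Q) _.
have := key s; have : horner_mx X (char_poly X) = 0 by apply: Cayley_Hamilton.
rewrite Es (monicP (char_poly_monic X)) scale1r => ->; rewrite mulmx0 sub0r.
move=> /(lin_closedZ (-1) (rowspace_lin Q)); rewrite scaleN1r opprK => Us.
apply: contrapT => /negP mus; apply: nUv.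
rewrite -[v]scale1r -(@mulVf _ (\prod_(z <- s) (mu - z))).
  by rewrite -scalerA; apply: lin_closedZ (rowspace_lin Q) _.
rewrite prodf_seq_neq0; apply/allP => z zs /=; rewrite subr_eq0.
by apply: contraNneq mus => ->.
Qed.

(** The columns of [cokermx Q] test membership in the row space of [Q], so these trace forms vanish
    at [g] when [v g] has weight [mu] modulo [U]. *)
Definition weight_forms X mu v : set 'M[K]_n.+1 :=
  [set Y | exists j, Y = (X - mu%:M) *m cokermx Q *m (delta_mx j 0 : 'cV_n.+1) *m v].

Lemma weight_formsP X mu v g : pset (ann (weight_forms X mu v)) (\pi_PGL g) <->
  U (v *m val g *m X - mu *: (v *m val g)).
Proof.
rewrite pset_pi; last exact: ann_lin.
have trE (C : 'M_n.+1) j :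
    \tr ((X - mu%:M) *m C *m (delta_mx j 0 : 'cV_n.+1) *m v *m val g)
    = ((v *m val g *m X - mu *: (v *m val g)) *m C) 0 j.
  rewrite -[_ *m v *m _]mulmxA mxtrace_mulC /mxtrace big_ord1 !mulmxA -colE mxE.
  by rewrite mulmxBr mul_mx_scalar.
split=> [Sg|Ug _ [j ->]].
  rewrite /rowspace /= submxE; apply/eqP/rowP => j; rewrite [RHS]mxE -trE.
  by apply: Sg; exists j.
by rewrite trE; move: Ug; rewrite /rowspace /= submxE => /eqP ->; rewrite mxE.
Qed.

(* The [h] in [G] for which [v h] has weight [mu] form a closed set, and only
   finitely many [mu] occur. *)
Lemma weight_constant G X v lam :
  connected G -> G 1%g -> stable G U -> (forall u, U u -> U (u *m X)) ->
  ~ U v -> U (v *m X - lam *: v) ->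
  (forall h, G (\pi_PGL h) -> exists mu, U (v *m val h *m X - mu *: (v *m val h))) ->
  forall h, G (\pi_PGL h) -> U (v *m val h *m X - lam *: (v *m val h)).
Proof.
move=> cG G1 stU UX nUv Uv wt h Gh.
have [s Hs] := eigenvalues_mod UX.
(* [g] maps [U] into itself without loss of rank, hence onto itself, and nothing outside [U] can
   enter it. *)
have nUvh g : G (\pi_PGL g) -> ~ U (v *m val g).
  move=> Gg; rewrite /rowspace /= => sub; apply: nUv.
  have sQ : (Q *m val g <= Q)%MS.
    by apply/row_subP => i; rewrite row_mul; apply: (stU g Gg); apply: row_sub.
  have rQ : \rank (Q *m val g) = \rank Q.
    by rewrite mxrankMfree // row_free_unit; apply: valP.
  have : (Q <= Q *m val g)%MS by rewrite -(geq_leqif (mxrank_leqif_sup sQ)) rQ.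
  move=> /(submx_trans sub)/(submxMr (invmx (val g))).
  by rewrite !mulmxK //; apply: valP.
pose C mu := pset (ann (weight_forms X mu v)).
suff BG : G `&` C lam = G by rewrite -BG in Gh; case: Gh => _ /weight_formsP.
apply: cG.
- exists 1%g; split=> //; rewrite -pgl_pi1; apply/weight_formsP.
  by rewrite val_gl1 mulmx1.
(* Within [G], the set [C lam] is the complement of finitely many closed sets, one for each other
   weight; [undup] ensures that [rem] leaves no copy of [lam]. *)
- exists (~` (\big[setU/set0]_(mu <- rem lam (undup s)) C mu)).
    by rewrite openC; apply: closed_bigsetU => mu _; apply: pset_ann_closed.
  apply/seteqP; split=> x [Gx Cx]; split=> //; have [g gx] := pglP x.
    rewrite gx => Cg; move: Cx; rewrite gx => /weight_formsP Clam.
    have [mu [mus /weight_formsP Cmu]] : exists mu, mu \in rem lam (undup s) /\ C mu (\pi_PGL g).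
      elim: (rem _ _) Cg => [|mu t IHt]; rewrite ?big_nil // big_cons.
      case=> [Cmu|/IHt[mu' [mut Cmu']]]; first by exists mu; rewrite mem_head.
      by exists mu'; rewrite inE mut orbT.
    have := lin_closedB (rowspace_lin Q) Cmu Clam.
    rewrite opprB addrC addrA addrNK -scalerBl => Ud.
    have [e|nlam] := eqVneq lam mu.
      by move: mus; rewrite e mem_rem_uniqF ?undup_uniq.
    exfalso; apply: (nUvh g); first by rewrite -gx.
    rewrite -[_ *m _]scale1r -(@mulVf _ (lam - mu)) ?subr_eq0 // -scalerA.
    exact: lin_closedZ (rowspace_lin Q) _.
  have Gg : G (\pi_PGL g) by rewrite -gx.
  have [mu Umu] := wt _ Gg; have mus := Hs _ _ (nUvh _ Gg) Umu.
  have [<-|nlam] := eqVneq mu lam; first by rewrite gx; apply/weight_formsP.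
  exfalso; apply: Cx; rewrite gx.
  have : mu \in rem lam (undup s) by rewrite mem_rem_uniq ?undup_uniq // !inE nlam mem_undup.
  elim: (rem _ _) => // mu' t IHt; rewrite inE big_cons => /orP[/eqP <-|/IHt].
    by left; apply/weight_formsP.
  by right.
- by exists (C lam) => //; apply: pset_ann_closed.
Qed.

(** The vectors of [W] all of whose translates have weight [lam] form a stable space containing [U]
    and [v]; minimality makes it all of [W]. *)
Lemma minimal_weight_constant G W X v :
  connected G -> subgroup G -> stable G U -> (forall u, U u -> U (u *m X)) ->
  lin_closed W -> stable G W -> U `<=` W ->
  (forall V, lin_closed V -> stable G V -> U `<=` V -> (exists2 v, V v & ~ U v) ->
    V `<=` W -> W `<=` V) ->
  W v -> ~ U v ->
  (forall h, G (\pi_PGL h) -> exists mu, U (v *m val h *m X - mu *: (v *m val h))) ->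
  exists lam, forall w, W w -> U (w *m X - lam *: w).
Proof.
move=> cG sG stU UX linW stW UW minW Wv nUv wt.
have [lam] := wt 1%g (subgroup1 sG); rewrite val_gl1 mulmx1 => Ulam; exists lam.
have allh := weight_constant cG (subgroup1 sG) stU UX nUv Ulam wt.
pose V := [set w | W w /\
  forall h, G (\pi_PGL h) -> U (w *m val h *m X - lam *: (w *m val h))].
suff WV : W `<=` V.
  by move=> w /WV[_ /(_ 1%g (subgroup1 sG))]; rewrite val_gl1 mulmx1.
apply: minW.
- split=> [|c w1 w2 [Ww1 Uw1] [Ww2 Uw2]].
    by split=> [|h _]; [case: linW | rewrite !mul0mx scaler0 subrr; apply: sub0mx].
  split=> [|h Gh]; first by case: linW => _; apply.
  have [_ UD] := rowspace_lin Q.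
  have := UD c _ _ (Uw1 h Gh) (Uw2 h Gh).
  rewrite scalerBr !mulmxDl -!scalemxAl scalerDr !scalerA (mulrC lam).
  by rewrite opprD addrACA.
- move=> g Gg w [Ww Uw]; split=> [|h Gh]; first exact: stW.
  rewrite -[w *m _ *m val h]mulmxA; apply: (Uw (g * h)%g).
  by rewrite pgl_piM; apply: subgroupM.
- move=> u Uu; split=> [|h Gh]; first exact: UW.
  apply: lin_closedB (rowspace_lin Q) _ _; first by apply/UX/stU.
  by apply: lin_closedZ (rowspace_lin Q) _; apply: stU.
- by exists v.
- by move=> w [].
Qed.

(** Induction on the derived length. On a minimal stable space above [U] the derived subgroup acts
    by scalars modulo [U], and then so does the whole group. *)
Lemma common_eigenvector_mod m G W :
  connected G -> subgroup G -> iter m (@derived_subgroup _) G = [set 1%g] ->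
  stable G U -> lin_closed W -> stable G W -> U `<=` W -> (exists2 v, W v & ~ U v) ->
  exists v, [/\ W v, ~ U v &
    forall g, G (\pi_PGL g) -> exists mu, U (v *m val g - mu *: v)].
Proof.
elim: m G W => [|m IHm] G W cG sG /= derG stU linW stW UW nU.
  have [v0 Wv0 nUv0] := nU; exists v0; split=> // g; rewrite derG /= => /pgl_eqP[c _ ->].
  exists c; rewrite val_gl1 scalemx1 mul_mx_scalar subrr; apply: sub0mx.
have [W0 [[linW0 stW0 UW0 W0W] [nUW0 minW0]]] :=
  minimal_stable linW stW UW nU.
have DG := derived_subgroup_sub sG.
have [v [W0v nUv eigv]] : exists v, [/\ W0 v, ~ U v &
    forall g, derived_subgroup G (\pi_PGL g) -> exists mu, U (v *m val g - mu *: v)].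
  apply: IHm => //; first exact: derived_connected.
  - exact: derived_subgroup_subgroup.
  - by rewrite -iterSr.
  - by move=> g /DG; apply: stU.
  - by move=> g /DG; apply: stW0.
have wtD a : derived_subgroup G (\pi_PGL a) ->
    exists lam, forall w, W0 w -> U (w *m val a - lam *: w).
  move=> Da; apply: (minimal_weight_constant cG sG stU _ linW0 stW0 UW0 minW0 W0v nUv).
    by move=> u; apply: stU; apply: DG.
  (* [v] is an eigenvector of this conjugate of [a], which makes [v h] an eigenvector of [a]. *)
  move=> h Gh; have [|mu Umu] := eigv (h * a * h^-1)%g.
    by rewrite !pgl_piM pgl_piV; apply: derived_subgroupJ.
  exists mu; move: (stU h Gh _ Umu); rewrite mulmxBl -scalemxAl.
  by rewrite !val_glM -!mulmxA mulVmx ?mulmx1 //; apply: valP.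
have wtG g : G (\pi_PGL g) -> exists lam, forall w, W0 w -> U (w *m val g - lam *: w).
  move=> Gg; have [w W0w nUw] := nUW0.
  have [v1 [lam [W0v1 nUv1 Uv1]]] :=
    eigenvector_mod linW0 (stW0 g Gg) W0w nUw.
  apply: (minimal_weight_constant cG sG stU (stU g Gg) linW0 stW0 UW0 minW0 W0v1 nUv1).
  (* [h g] is [g h] preceded by a commutator, which acts by a scalar [mu]; so [v1 h] has weight
     [mu * lam] for [g]. *)
  move=> h Gh; have [|mu Umu] := wtD [~ h^-1, g^-1]%g.
    rewrite /commg /conjg !(pgl_piM, pgl_piV).
    by apply: (derived_subgroupR (subgroupV sG Gh) (subgroupV sG Gg)).
  have hg : val h *m val g = val [~ h^-1, g^-1]%g *m val g *m val h.
    rewrite -!val_glM; congr val.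
    by rewrite /commg /conjg !invgK !mulgA !mulgVK.
  exists (mu * lam).
  have U1 := stU h Gh _ (stU g Gg _ (Umu _ W0v1)).
  have U2 := lin_closedZ mu (rowspace_lin Q) (stU h Gh _ Uv1).
  have := lin_closedD (rowspace_lin Q) U1 U2.
  rewrite !mulmxBl -!scalemxAl scalerBr scalerA addrA addrNK.
  by rewrite -[v1 *m val h *m val g]mulmxA hg !mulmxA.
have [w W0w nUw] := nUW0; exists w; split=> //; first exact: W0W.
by move=> g /wtG[lam]; exists lam; auto.
Qed.

End Modulo.

(** A flag is built row by row, each new row being a common eigenvector modulo the previous ones. As
    the group acts on rows, the matrices become lower triangular. *)
Lemma connected_solvable_trig G :
  connected G -> subgroup G -> solvable_subgroup G ->
  exists2 Q : 'M[K]_n.+1, Q \in unitmx &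
    forall g, G (\pi_PGL g) -> is_trig_mx (Q *m val g *m invmx Q).
Proof.
move=> cG sG [m derG].
suff flag r : (r <= n.+1)%N -> exists2 Q : 'M[K]_(r, n.+1), row_free Q &
    forall g, G (\pi_PGL g) -> exists2 L : 'M_r, is_trig_mx L & Q *m val g = L *m Q.
  have [Q] := flag n.+1 (leqnn _); rewrite row_free_unit => Qu trQ.
  by exists Q => // g /trQ[L trL ->]; rewrite mulmxK.
elim: r => [|r IHr] rn.
  exists 0; first by rewrite /row_free mxrank0.
  by move=> g _; exists 0; [apply/is_trig_mxP => -[] | rewrite !mul0mx].
have [Q Qfree trQ] := IHr (ltnW rn).
have stU : stable G (rowspace Q).
  move=> g /trQ[L _ QL] v; rewrite /rowspace /= => /(submxMr (val g)) vQ.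
  by apply: submx_trans vQ _; rewrite QL submxMl.
have [v [_ nUv eigv]] : exists v, [/\ setT v, ~ rowspace Q v &
    forall g, G (\pi_PGL g) -> exists mu, rowspace Q (v *m val g - mu *: v)].
  apply: (common_eigenvector_mod cG sG derG) => //.
  apply: contrapT => nv.
  have : (1%:M <= Q)%MS.
    apply/row_subP => i; apply: contrapT => /negP Qi; apply: nv.
    by exists (row i 1%:M) => //; apply/negP.
  by move/mxrankS; rewrite mxrank1 (eqP Qfree) leqNgt rn.
rewrite -addn1; exists (col_mx Q v).
  rewrite /row_free -addsmxE eqn_leq; apply/andP; split.
    by rewrite addsmxE rank_leq_row.
  have := ltn_leqif (mxrank_leqif_sup (addsmxSl Q v)).
  rewrite (eqP Qfree) addn1 => ->; apply/negP => sub; apply: nUv.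
  exact: submx_trans (addsmxSr _ _) sub.
move=> g Gg; have [L trL QL] := trQ g Gg; have [mu] := eigv g Gg.
case/submxP=> D vD; exists (block_mx L 0 D mu%:M).
  by rewrite is_trig_block_mx // eqxx trL scalar_mx_is_trig.
rewrite mul_col_mx mul_block_col QL mul0mx addr0 mul_scalar_mx -vD.
by rewrite subrK.
Qed.

End LieKolchin.

(** * Triangular matrices and their derived series *)

Section Triangular.
Variables (K : fieldType) (n : nat).
Local Notation GL := (GL K n.+1).
Local Notation PGL := (PGL K n.+1).
Implicit Types (g h : GL) (x y : PGL) (A : set 'M[K]_n.+1) (Q X Y : 'M[K]_n.+1).

(** The filtration by subdiagonals: triangular for [j = 0], strictly triangular for [j = 1], zero
    for [j = n.+1]. *)
Definition low j : set 'M[K]_n.+1 :=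
  [set X | forall p q : 'I_n.+1, (p < q + j)%N -> X p q = 0].

Definition scalar_low j : set 'M[K]_n.+1 := [set X | exists c, low j (X - c%:M)].

Definition conjset Q A : set 'M[K]_n.+1 := [set X | A (Q *m X *m invmx Q)].

Lemma low_trig X : low 0 X <-> is_trig_mx X.
Proof.
split=> [Xl|/is_trig_mxP Xt p q]; last by rewrite addn0; apply: Xt.
by apply/is_trig_mxP => p q pq; apply: Xl; rewrite addn0.
Qed.

Lemma low_lin j : lin_closed (low j).
Proof.
split=> [p q _|c X Y Xl Yl p q pq]; rewrite !mxE // Xl // Yl //.
by rewrite mulr0 addr0.
Qed.

Lemma low_leq i j : (i <= j)%N -> low j `<=` low i.
Proof. by move=> ij X Xl p q pq; apply: Xl; apply: leq_trans pq _; rewrite leq_add2l. Qed.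

Lemma low_mul i j X Y : low i X -> low j Y -> low (i + j) (X *m Y).
Proof.
move=> Xl Yl p q pq; rewrite mxE big1 // => l _.
have [pl|lp] := ltnP p (l + i); first by rewrite Xl // mul0r.
rewrite [Y l q]Yl ?mulr0 // -(ltn_add2r i); apply: leq_ltn_trans lp _.
by rewrite -addnA (addnC j).
Qed.

Lemma low_scalar c : low 0 c%:M.
Proof. by apply/low_trig; apply: scalar_mx_is_trig. Qed.

Lemma scalar_low_sub j : scalar_low j `<=` low 0.
Proof.
move=> X [c Xc]; rewrite -[X](subrK c%:M).
by apply: lin_closedD (low_lin 0) (low_leq (leq0n j) Xc) (low_scalar c).
Qed.

Lemma scalar_low0 : scalar_low 0 = low 0.
Proof.
apply/seteqP; split=> [|X Xl]; first exact: scalar_low_sub.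
by exists 0; rewrite raddf0 subr0.
Qed.

Lemma scalar_low_subalgebra j : subalgebra (scalar_low j).
Proof.
have linj := low_lin j.
have low_mull X Y : low 0 X -> low j Y -> low j (X *m Y) by apply: low_mul.
have low_mulr X Y : low j X -> low 0 Y -> low j (X *m Y).
  by move=> Xl Yl; have := low_mul Xl Yl; rewrite addn0.
split.
- split=> [|c X Y [d Xd] [e Ye]]; first by exists 0; rewrite raddf0 subr0; case: linj.
  exists (c * d + e).
  have -> : c *: X + Y - (c * d + e)%:M = c *: (X - d%:M) + (Y - e%:M).
    by rewrite raddfD /= scalerBr scale_scalar_mx opprD addrACA.
  by case: linj => _; apply.
- by exists 1; rewrite subrr; case: linj.
move=> X Y /[dup] [[d Xd]] /scalar_low_sub X0 [e Ye]; exists (d * e).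
have -> : X *m Y - (d * e)%:M = e *: (X - d%:M) + X *m (Y - e%:M).
  rewrite mulmxBr mul_mx_scalar scalerBr scale_scalar_mx (mulrC e).
  by rewrite [RHS]addrC addrA subrK.
by case: linj => _; apply=> //; apply: low_mull.
Qed.

Lemma conjset_subalgebra Q A :
  Q \in unitmx -> subalgebra A -> subalgebra (conjset Q A).
Proof.
move=> Qu [linA A1 AM]; split.
- split=> [|c X Y AX AY]; rewrite /conjset /=.
    by rewrite mulmx0 mul0mx; case: linA.
  by rewrite mulmxDr mulmxDl -scalemxAr -scalemxAl; case: linA => _; apply.
- by rewrite /conjset /= mulmx1 mulmxV.
- move=> X Y AX AY; rewrite /conjset /=.
  by rewrite -[Q](mulmxKV Qu) -!mulmxA !(mulmxA _ X) in AX *; have := AM _ _ AX AY;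
     rewrite !mulmxA !(mulmxKV Qu).
Qed.

(** Scalars cancel in the commutator. For positive [j] both products already lie in [low (j + j)];
    for [j = 0] their diagonals agree. *)
Lemma low_commutator j X Y : scalar_low j X -> scalar_low j Y ->
  low j.+1 (X *m Y - Y *m X).
Proof.
move=> [d Xd] [e Ye].
have -> : X *m Y - Y *m X =
    (X - d%:M) *m (Y - e%:M) - (Y - e%:M) *m (X - d%:M).
  rewrite !mulmxBl !mulmxBr !mul_mx_scalar !mul_scalar_mx !scale_scalar_mx.
  by rewrite (mulrC e); apply/matrixP => p q; rewrite !mxE; ring.
move: (X - _) (Y - _) Xd Ye => X' Y' Xl Yl; case: j Xl Yl => [|j] Xl Yl.
  have diag (Z T : 'M[K]_n.+1) p : low 0 Z -> low 0 T -> (Z *m T) p p = Z p p * T p p.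
    move=> Zl Tl; rewrite mxE (bigD1 p) //= big1 ?addr0 // => l lp.
    have [pl|] := ltnP p l; first by rewrite Zl ?addn0 // mul0r.
    rewrite leq_eqVlt (negbTE lp : (l == p :> nat) = false) /= => pl.
    by rewrite Tl ?addn0 // mulr0.
  move=> p q; rewrite addn1 ltnS leq_eqVlt => /orP[/eqP/val_inj <-|pq].
    by rewrite mxE [X in _ + X]mxE !diag // mulrC subrr.
  have [XY YX] := (low_mul Xl Yl, low_mul Yl Xl).
  by rewrite mxE [X in _ + X]mxE XY ?YX ?subrr // !addn0.
have lej : (j.+2 <= j.+1 + j.+1)%N by rewrite addSn ltnS leq_addl.
by apply: lin_closedB (low_lin _) _ _; apply: (low_leq lej); apply: low_mul.
Qed.

Definition flag_group Q : set PGL := pset (conjset Q (low 0)).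

Lemma conjset_low_subalgebra Q : Q \in unitmx -> subalgebra (conjset Q (low 0)).
Proof.
by move=> Qu; apply: conjset_subalgebra => //; rewrite -scalar_low0; apply: scalar_low_subalgebra.
Qed.

Lemma flag_groupP Q g : Q \in unitmx ->
  flag_group Q (\pi_PGL g) <-> is_trig_mx (Q *m val g *m invmx Q).
Proof.
move=> Qu; rewrite -low_trig; apply: pset_pi.
by case: (conjset_low_subalgebra Qu).
Qed.

Lemma mxtrace_delta Y (p q : 'I_n.+1) : \tr (delta_mx q p *m Y) = Y p q.
Proof.
rewrite -(mul_delta_mx (0 : 'I_1)) -mulmxA mxtrace_mulC -rowE.
by rewrite /mxtrace big_ord1 -colE !mxE.
Qed.

(** Entries of a conjugate are trace forms, so being triangular in a given basis is a condition of
    the shape [ann]. *)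
Lemma conjset_entry Q X (p q : 'I_n.+1) :
  \tr (invmx Q *m delta_mx q p *m Q *m X) = (Q *m X *m invmx Q) p q.
Proof. by rewrite -mxtrace_delta -!mulmxA mxtrace_mulC -!mulmxA. Qed.

Lemma conjset_low_ann Q : conjset Q (low 0) =
  ann [set invmx Q *m delta_mx pq.2 pq.1 *m Q |
    pq in [set pq : 'I_n.+1 * 'I_n.+1 | (pq.1 < pq.2)%N]].
Proof.
apply/seteqP; split=> X.
  by move=> Xl _ [[p q] /= pq <-]; rewrite conjset_entry Xl ?addn0.
move=> SX p q; rewrite addn0 => pq; rewrite -conjset_entry; apply: SX.
by exists (p, q).
Qed.

(** [[g, h] - 1 = (h g)^-1 (g h - h g)], and [low_commutator] gains one subdiagonal in the second
    factor. *)
Lemma derived_scalar_low Q j : Q \in unitmx ->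
  derived_subgroup (pset (conjset Q (scalar_low j))) `<=`
  pset (conjset Q (scalar_low j.+1)).
Proof.
move=> Qu; have subj i := conjset_subalgebra Qu (scalar_low_subalgebra i).
have linj i : lin_closed (conjset Q (scalar_low i)) by case: (subj i).
apply: derived_subgroup_min; first exact: pset_subgroup.
move=> x y; have [g ->] := pglP x; have [h ->] := pglP y.
move=> /(pset_pi g (linj j)) Ag /(pset_pi h (linj j)) Ah.
have -> : [~ \pi_PGL g, \pi_PGL h]%g = \pi_PGL [~ g, h]%g.
  by rewrite /commg /conjg !(pgl_piM, pgl_piV).
apply/pset_pi; first exact: linj.
set X := Q *m val g *m invmx Q; set Y := Q *m val h *m invmx Q.
set Z := Q *m val ((h * g)^-1)%g *m invmx Q.
have conjM a b : Q *m val (a * b : GL)%g *m invmx Q =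
    (Q *m val a *m invmx Q) *m (Q *m val b *m invmx Q).
  by rewrite !mulmxA mulmxKV.
have e1 : Z *m (Y *m X) = 1%:M by rewrite -!conjM mulVg mulmx1 mulmxV.
have eZ : Q *m val [~ g, h]%g *m invmx Q = Z *m (X *m Y).
  by rewrite /Z -!conjM; congr (_ *m val _ *m _); rewrite /commg /conjg invgM !mulgA.
rewrite /conjset /= eZ.
exists 1; rewrite -e1 -mulmxBr.
rewrite -[j.+1]add0n; apply: low_mul; last exact: low_commutator.
apply: (@scalar_low_sub j).
have Ahg : conjset Q (scalar_low j) (val (h * g)%g) by case: (subj j) => _ _; apply.
exact: subalgebra_invmx (subj j) (valP _) Ahg.
Qed.

(** Each derived subgroup goes down one subdiagonal; after [n.+1] steps only scalars remain, and
    these are trivial in the projective group. *)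
Lemma flag_group_solvable Q : Q \in unitmx -> solvable_subgroup (flag_group Q).
Proof.
move=> Qu; exists n.+1.
have sub j : iter j (@derived_subgroup _) (flag_group Q) `<=`
    pset (conjset Q (scalar_low j)).
  elim: j => [|j IHj] /=; first by rewrite scalar_low0.
  move=> z Dz; apply: (derived_scalar_low Qu); move: z Dz.
  apply: derived_subgroup_min; first exact: derived_subgroup_subgroup.
  by move=> x y Hx Hy; apply: derived_subgroupR; apply: IHj.
apply/seteqP; split=> [x|_ -> /=]; last first.
  by apply: subgroup1; apply: derived_subgroup_subgroup.
move=> /sub; have [g ->] := pglP x.
have [linA _ _] := conjset_subalgebra Qu (scalar_low_subalgebra n.+1).
move=> /(pset_pi g linA)[c /= Qc]; have Qgc : Q *m val g *m invmx Q = c%:M.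
  apply/eqP; rewrite -subr_eq0; apply/eqP/matrixP => p q; rewrite Qc ?mxE //.
  by rewrite (leq_trans (ltn_ord p)) // leq_addl.
have gc : val g = c *: 1%:M.
  rewrite scalemx1 -[val g]mul1mx -{1}(mulVmx Qu) -[_ *m _ *m _](mulmxKV Qu).
  by rewrite -!mulmxA (mulmxA Q) (mulmxA (Q *m _)) Qgc mul_scalar_mx -scalemxAr mulVmx // scalemx1.
apply/pgl_eqP; exists c => //; apply: contraTneq (gl_det_neq0 g) => c0.
by rewrite gc c0 scale0r det0 eqxx.
Qed.

End Triangular.

Section Borel.
Variables (K : closedFieldType) (n : nat).
Hypothesis Kinf : infinite_set [set: K].
Local Notation PGL := (PGL K n.+1).

(** Lie-Kolchin puts [B] inside a flag group, which is itself closed, connected and solvable;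
    maximality gives equality. *)
Lemma borel_flag_group (B : set PGL) : borel_subgroup B ->
  exists2 Q : 'M[K]_n.+1, Q \in unitmx & B = flag_group Q.
Proof.
move=> [[sB cB] conB solB maxB].
have [Q Qu trigB] := connected_solvable_trig conB sB solB; exists Q => //.
have subQ := conjset_low_subalgebra Qu.
apply/esym/maxB; last by move=> x; have [g ->] := pglP x => /trigB/flag_groupP; apply.
- split; first exact: pset_subgroup.
  by rewrite /flag_group conjset_low_ann; apply: pset_ann_closed.
- by apply: pset_connected => //; case: subQ.
- exact: flag_group_solvable.
Qed.

End Borel.

(** * Matrix groups containing all invertible lower triangular matrices *)

Section OvergroupsOfTriangular.
Variables (K : fieldType) (n : nat).
Implicit Types (X Y : 'M[K]_n.+1) (x : 'cV[K]_n.+1) (y z : 'rV[K]_n.+1).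

Local Notation e0 := (delta_mx 0 0 : 'cV[K]_n.+1).
Local Notation f0 := (delta_mx 0 0 : 'rV[K]_n.+1).

(** Sherman-Morrison: with [s = y x], the inverse is [1 - (1 + s)^-1 x y]. *)
Lemma rank1_unit x y : 1 + (y *m x) 0 0 != 0 -> 1%:M + x *m y \in unitmx.
Proof.
move: ((y *m x) 0 0) (mx11_scalar (y *m x)) => s yx s0.
have : x *m y *m (x *m y) = s *: (x *m y).
  by rewrite mulmxA -[x *m y *m x]mulmxA yx mul_mx_scalar -scalemxAl.
move: (x *m y) => A AA.
have : (1%:M + A) *m (1%:M - (1 + s)^-1 *: A) = 1%:M.
  rewrite mulmxDl mul1mx mulmxBr mulmx1 -scalemxAr AA.
  by apply/matrixP => i j; rewrite !mxE; field.
by case/mulmx1_unit.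
Qed.

Lemma rank1_unit0 x y : (y *m x) 0 0 = 0 -> 1%:M + x *m y \in unitmx.
Proof. by move=> yx; apply: rank1_unit; rewrite yx addr0 oner_eq0. Qed.

Lemma rank1_unitE x y : 1%:M + x *m y \in unitmx -> 1 + (y *m x) 0 0 != 0.
Proof.
move=> xyu; apply/eqP => s0.
have yk : y *m (1%:M + x *m y) = 0.
  rewrite mulmxDr mulmx1 mulmxA (mx11_scalar (y *m x)) mul_scalar_mx.
  by rewrite -{1}[y]scale1r -scalerDl s0 scale0r.
have y0 : y = 0 by rewrite -[y](mulmxK xyu) yk mul0mx.
by move/eqP: s0; rewrite y0 mul0mx mxE addr0 oner_eq0.
Qed.

Lemma mul_rank1 x y x' y' : (y *m x') 0 0 = 0 ->
  (1%:M + x *m y) *m (1%:M + x' *m y') = 1%:M + x *m y + x' *m y'.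
Proof.
move=> yx; rewrite mulmxDl mul1mx mulmxDr mulmx1 mulmxA -[x *m y *m x']mulmxA.
rewrite (mx11_scalar (y *m x')) yx raddf0 mulmx0 mul0mx addr0.
by rewrite addrAC.
Qed.

Lemma low_rank1 x y :
  (forall p q : 'I_n.+1, (p < q)%N -> x p 0 * y 0 q = 0) -> low 0 (1%:M + x *m y).
Proof.
move=> xy p q; rewrite addn0 => pq.
by rewrite !mxE big_ord1 xy // addr0 -val_eqE /= ltn_eqF.
Qed.

Variable M : set 'M[K]_n.+1.
Hypothesis M_unit : forall X, M X -> X \in unitmx.
Hypothesis M_mul : forall X Y, M X -> M Y -> M (X *m Y).
Hypothesis M_inv : forall X, M X -> M (invmx X).
Hypothesis M_low : forall X, X \in unitmx -> low 0 X -> M X.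

Lemma rank1_conj_mem X x y : M X ->
  M (1%:M + x *m y) -> M (1%:M + X *m x *m (y *m invmx X)).
Proof.
move=> MX Mxy; have Xu := M_unit MX.
have -> : 1%:M + X *m x *m (y *m invmx X) = X *m (1%:M + x *m y) *m invmx X.
  by rewrite mulmxDr mulmxDl mulmx1 mulmxV // !mulmxA.
by apply: M_mul; [apply: M_mul | apply: M_inv].
Qed.

Lemma mulmx_e0 y : (y *m e0) 0 0 = y 0 0.
Proof. by rewrite -colE !mxE. Qed.

Lemma f0_mulmx x : (f0 *m x) 0 0 = x 0 0.
Proof. by rewrite -rowE !mxE. Qed.

Lemma low_col_rank1 x : low 0 (1%:M + x *m f0).
Proof.
apply: low_rank1 => p q pq; rewrite [f0 _ _]mxE /=.
by rewrite -val_eqE /= gtn_eqF ?mulr0 // (leq_ltn_trans _ pq).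
Qed.

Section CornerEntry.
Variable g : 'M[K]_n.+1.
Hypotheses (Mg : M g) (g_corner : g 0 ord_max != 0).

(* Clearing the last column of [g] with a lower triangular matrix gives [g'] in
   [M] mapping the last basis vector to a multiple of the first one, so that
   conjugation by [g'] turns the last row of the lower triangular group into
   the first row. *)
Lemma first_row0_mem y : y 0 0 = 0 -> M (1%:M + e0 *m y).
Proof.
move=> y0; set c := g 0 ord_max.
pose em : 'cV[K]_n.+1 := delta_mx ord_max 0.
pose x := c^-1 *: (g *m em) - e0.
have x0 : x 0 0 = 0 by rewrite /x -colE !mxE eqxx mulVf ?subrr.
pose g' := (1%:M + (- x) *m f0) *m g.
have Mg' : M g'.
  apply: M_mul => //; apply: M_low (low_col_rank1 _).
  by apply: rank1_unit0; rewrite f0_mulmx mxE x0 oppr0.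
have g'em : g' *m em = c *: e0.
  rewrite /g' -mulmxA mulmxDl mul1mx -mulmxA (mx11_scalar (f0 *m _)) f0_mulmx.
  rewrite -[g *m em]colE [col _ _ _ _]mxE mul_mx_scalar scalerN scalerBr scalerA mulfV //.
  by rewrite scale1r opprB colE addrCA subrr addr0.
(* The factor [c^-1] compensates for [g' em = c e0] when [1 + em z] is conjugated by [g']. *)
pose z := c^-1 *: (y *m g').
have zem : (z *m em) 0 0 = 0.
  by rewrite -scalemxAl -mulmxA g'em -scalemxAr scalerA mulVf // scale1r mulmx_e0.
have : M (1%:M + em *m z).
  apply: M_low; first exact: rank1_unit0.
  apply: low_rank1 => p q pq; rewrite [em _ _]mxE andbT.
  by rewrite -val_eqE /= ltn_eqF ?mul0r // (leq_trans pq) // -ltnS.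
move/(rank1_conj_mem Mg'); rewrite g'em /z -[(_ *: _) *m invmx _]scalemxAl.
rewrite mulmxK; last exact: M_unit.
by rewrite -scalemxAl -scalemxAr scalerA mulfV // scale1r.
Qed.

(** The diagonal coordinate of [y] splits off as a lower triangular factor, which leaves the case of
    [first_row0_mem]. *)
Lemma first_row_mem y : 1%:M + e0 *m y \in unitmx -> M (1%:M + e0 *m y).
Proof.
move=> yu; have y0 := rank1_unitE yu; rewrite mulmx_e0 in y0.
pose z := y - y 0 0 *: f0.
have z0 : z 0 0 = 0 by rewrite !mxE eqxx mulr1 subrr.
have -> : 1%:M + e0 *m y =
    (1%:M + e0 *m z) *m (1%:M + (y 0 0 *: e0) *m f0).
  rewrite mul_rank1; last by rewrite -scalemxAr mxE mulmx_e0 z0 mulr0.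
  by rewrite -addrA -scalemxAl scalemxAr -mulmxDr subrK.
apply: M_mul; first exact: first_row0_mem.
apply: M_low; last exact: low_col_rank1.
by apply: rank1_unit; rewrite f0_mulmx !mxE eqxx mulr1.
Qed.

(** If [x] has nonzero first coordinate, a lower triangular matrix sends [e0] to [x] and conjugation
    reduces to the first row. Otherwise an element [1 + e0 z] of [M] first makes that coordinate
    nonzero. *)
Lemma rank1_mem x y : 1%:M + x *m y \in unitmx -> M (1%:M + x *m y).
Proof.
have key x' y' : x' 0 0 != 0 -> 1%:M + x' *m y' \in unitmx -> M (1%:M + x' *m y').
  move=> x'0 x'y'u; pose a := 1%:M + (x' - e0) *m f0.
  have au : a \in unitmx.
    by apply: rank1_unit; rewrite f0_mulmx !mxE eqxx addrCA subrr addr0.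
  have Ma : M a by apply: M_low => //; apply: low_col_rank1.
  have ae0 : a *m e0 = x'.
    rewrite mulmxDl mul1mx -mulmxA (mx11_scalar (f0 *m e0)) f0_mulmx mxE eqxx.
    by rewrite mulmx1 addrCA subrr addr0.
  have -> : 1%:M + x' *m y' = 1%:M + a *m e0 *m ((y' *m a) *m invmx a).
    by rewrite mulmxK // ae0.
  apply: rank1_conj_mem => //; apply: first_row_mem; apply: rank1_unit.
  by rewrite -mulmxA ae0; apply: rank1_unitE.
move=> xyu; have [x0|] := eqVneq (x 0 0) 0; last by move=> x0; apply: key.
have [->|] := eqVneq x 0.
  by rewrite mul0mx addr0; apply: M_low (unitmx1 _ _) (@low_scalar _ _ _).
case/matrix0Pn=> p [j]; rewrite ord1 => xp.
have p0 : p != 0 by apply: contraNneq xp => ->; rewrite x0.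
pose z : 'rV[K]_n.+1 := delta_mx 0 p; pose m := 1%:M + e0 *m z.
have Mm : M m.
  by apply: first_row0_mem; rewrite mxE eqxx /= eq_sym (negbTE p0).
have mu := M_unit Mm.
have mx0 : (m *m x) 0 0 != 0.
  rewrite mulmxDl mul1mx -mulmxA mxE x0 add0r (mx11_scalar (z *m x)).
  by rewrite -rowE mul_mx_scalar !mxE eqxx mulr1.
have -> : 1%:M + x *m y = 1%:M + invmx m *m (m *m x) *m ((y *m invmx m) *m invmx (invmx m)).
  by rewrite invmxK mulmxKV // mulKmx.
apply: rank1_conj_mem; first exact: M_inv.
apply: key => //; apply: rank1_unit.
by rewrite !mulmxA mulmxKV //; apply: rank1_unitE.
Qed.

(** Gaussian elimination with factors of the form [1 + x y]: here [r] bounds the number of columns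
    that are not yet standard. *)
Lemma unitmx_mem X : X \in unitmx -> M X.
Proof.
suff H r Y : (r <= n.+1)%N -> Y \in unitmx ->
    (forall j : 'I_n.+1, (j < n.+1 - r)%N -> col j Y = delta_mx j 0) -> M Y.
  by move=> Xu; apply: (H n.+1) => //; rewrite subnn.
elim: r Y => [|r IHr] Y rn Yu colY.
  have -> : Y = 1%:M.
    apply/matrixP => i j.
    have /matrixP/(_ i 0) : col j Y = delta_mx j 0 by apply: colY; rewrite subn0.
    by rewrite !mxE eqxx andbT.
  exact: M_low (unitmx1 _ _) (@low_scalar _ _ _).
have rn' : (n.+1 - r.+1 < n.+1)%N by rewrite ltn_subrL.
pose s := Ordinal rn'.
have [v vE] : exists v, col s Y = v by exists (col s Y).
have es : (n.+1 - r = (n.+1 - r.+1).+1)%N by rewrite subSn.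
(* Were column [s] zero from row [s] on, [Y] would fix it, hence send both it and the [s]-th basis
   vector to the same image. *)
have [q sq vq] : exists2 q : 'I_n.+1, (s <= q)%N & v q 0 != 0.
  apply: contrapT => nv.
  have v0 (q : 'I_n.+1) : (s <= q)%N -> v q 0 = 0.
    by move=> sq; apply: contrapT => /eqP vq; apply: nv; exists q.
  have Yv : Y *m v = v.
    rewrite {1}[v]matrix_sum_delta mulmx_sumr [RHS]matrix_sum_delta.
    apply: eq_bigr => i _; rewrite !big_ord1 -scalemxAr.
    have [le_si|lt_is] := leqP s i; first by rewrite v0 ?scale0r.
    by rewrite -colE colY.
  have /(congr1 (mulmx (invmx Y))) : Y *m delta_mx s 0 = Y *m v by rewrite -colE vE Yv.
  rewrite !mulKmx // => vs; have := v0 s (leqnn _).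
  by rewrite -vs mxE !eqxx; apply/eqP; rewrite oner_eq0.
(* For the matrix [m] below, the three conditions say in turn that it fixes the standard columns,
   sends [v] to the [s]-th basis vector, and is invertible. *)
have [y [ylow yv ys]] : exists y : 'rV[K]_n.+1, [/\
    forall j : 'I_n.+1, (j < s)%N -> y 0 j = 0, (y *m v) 0 0 = 1 & y 0 s != 0].
  have [vs|vs] := eqVneq (v s 0) 0; last first.
    exists ((v s 0)^-1 *: delta_mx 0 s); split=> [j js||].
    - by rewrite !mxE eqxx /= -val_eqE /= ltn_eqF // mulr0.
    - by rewrite -scalemxAl -rowE !mxE mulVf // -[v s 0]mxE.
    - by rewrite !mxE !eqxx mulr1 invr_neq0.
  have qs : q != s by apply: contraNneq vq => ->; rewrite vs.
  exists (delta_mx 0 s + (v q 0)^-1 *: delta_mx 0 q); split=> [j js||].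
  - rewrite !mxE eqxx /= -!val_eqE /= ltn_eqF // ltn_eqF ?mulr0 ?addr0 //.
    exact: leq_trans js sq.
  - by rewrite mulmxDl -scalemxAl -!rowE mxE [row _ _ _ _]mxE vs add0r mxE mxE mulVf.
  - by rewrite !mxE !eqxx /= [s == q]eq_sym (negbTE qs) mulr0 addr0 oner_eq0.
pose m := 1%:M + (delta_mx s 0 - v) *m y.
have mu : m \in unitmx.
  apply: rank1_unit; rewrite mulmxBr mxE [X in _ + (_ + X)]mxE yv addrCA subrr addr0.
  by rewrite -colE mxE.
have Mm : M m by apply: rank1_mem.
rewrite -[Y](mulKmx mu); apply: M_mul; first exact: M_inv.
apply: IHr; first exact: ltnW.
  by rewrite unitmx_mul mu.
move=> j; rewrite es ltnS leq_eqVlt => /orP[/eqP js|js].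
  have -> : j = s by apply: val_inj.
  rewrite colE -mulmxA -colE vE mulmxDl mul1mx -mulmxA (mx11_scalar (y *m v)) yv.
  by rewrite mulmx1 addrCA subrr addr0.
rewrite colE -mulmxA -colE colY // mulmxDl mul1mx -mulmxA.
rewrite (mx11_scalar (y *m _)) -colE [col _ _ _ _]mxE ylow //.
by rewrite raddf0 mulmx0 addr0.
Qed.

End CornerEntry.
End OvergroupsOfTriangular.

(** * Descent to the ground field *)

Section Functionals.
Variables (k K : fieldType) (iota : {rmorphism k -> K}).

Definition klinear (phi : K -> k) : Prop :=
  forall c x y, phi (iota c * x + y) = c * phi x + phi y.

(* Zorn's lemma gives a [k]-subspace maximal among those avoiding [u]; it is a
   complement of the line spanned by [u]. *)
Lemma klinear_exists u : u != 0 -> exists2 phi, klinear phi & phi u = 1.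
Proof.
move=> u0.
pose P (V : set K) := (forall c x y, V x -> V y -> V (iota c * x + y)) /\ ~ V u.
have [|V [[VD nVu] Vmax]] := @Zorn_bigcup K P.
  move=> F FP Ftot; split=> [c x y [A FA Ax] [B FB By]|[A FA Au]]; last first.
    by case: (FP _ FA).
  have [AB|BA] := Ftot _ _ FA FB.
    by exists B => //; case: (FP _ FB) => BD _; apply: BD => //; apply: AB.
  by exists A => //; case: (FP _ FA) => AD _; apply: AD => //; apply: BA.
have VB c x y : V x -> V y -> V (x - iota c * y).
  by move=> Vx Vy; rewrite addrC -mulNr -rmorphN; apply: VD.
have V0 : V 0.
  apply: contrapT => nV0; have nV x : ~ V x.
    by move=> Vx; apply: nV0; rewrite -(subrr x) -{2}[x]mul1r -(rmorph1 iota); apply: VB.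
  apply: (Vmax [set 0]).
    by split=> [x /nV//|/(_ 0 erefl)].
  split=> [c x y -> ->|/eqP]; first by rewrite /= mulr0 addr0.
  by rewrite (negbTE u0).
have VZ c x : V x -> V (iota c * x) by move=> Vx; rewrite -[_ * _]addr0; apply: VD.
have Vsurj x : exists c, V (x - iota c * u).
  have [Vx|nVx] := pselect (V x).
    by exists 0; rewrite rmorph0 mul0r subr0.
  pose W := [set z | exists c v, V v /\ z = iota c * x + v].
  have VW : V `<=` W by move=> v Vv; exists 0, v; rewrite rmorph0 mul0r add0r.
  have nW : ~ P W.
    apply: Vmax; split=> // WV; apply/nVx/WV; exists 1, 0.
    by rewrite rmorph1 mul1r addr0.
  have [c [v [Vv ucv]]] : W u.
    apply: contrapT => nWu; apply: nW; split=> // c _ _ [d [v [Vv ->]]] [e [w [Vw ->]]].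
    exists (c * d + e), (iota c * v + w); split; first exact: VD.
    by rewrite rmorphD rmorphM; ring.
  have c0 : c != 0.
    by apply: contra_notN nVu => /eqP c0; rewrite ucv c0 rmorph0 mul0r add0r.
  exists c^-1; rewrite ucv mulrDr mulrA -rmorphM mulVf // rmorph1 mul1r.
  by rewrite opprD addrA subrr sub0r -mulNr -rmorphN; apply: VZ.
have Vuniq c d x : V (x - iota c * u) -> V (x - iota d * u) -> c = d.
  move=> Vc Vd; apply: contrapT => /eqP cd; apply: nVu.
  have := VZ (d - c)^-1 _ (VB 1 _ _ Vc Vd).
  rewrite rmorph1 mul1r opprB [_ - _ + _]addrC addrA addrNK -mulrBl -rmorphB.
  by rewrite mulrA -rmorphM mulVf ?rmorph1 ?mul1r // subr_eq0 eq_sym.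
have [phi phiP] := choice Vsurj; exists phi => [c x y|].
  apply: (Vuniq _ _ (iota c * x + y)) => //.
  have -> : iota c * x + y - iota (c * phi x + phi y) * u =
      iota c * (x - iota (phi x) * u) + (y - iota (phi y) * u).
    by rewrite rmorphD rmorphM; ring.
  exact: VD.
by apply: (Vuniq _ _ u) => //; rewrite rmorph1 mul1r subrr.
Qed.

Section KLinear.
Variable phi : K -> k.
Hypothesis phiL : klinear phi.

Lemma klinear0 : phi 0 = 0.
Proof.
have := phiL 0 0 0; rewrite rmorph0 !mul0r add0r => e.
by have := phiL (- 1) 0 0; rewrite mulr0 addr0 mulN1r addNr.
Qed.

Lemma klinearM c x : phi (x * iota c) = phi x * c.
Proof. by have := phiL c x 0; rewrite addr0 klinear0 addr0 mulrC => ->; rewrite mulrC. Qed.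

Lemma klinearD x y : phi (x + y) = phi x + phi y.
Proof. by have := phiL 1 x y; rewrite rmorph1 !mul1r. Qed.

Lemma klinear_sum I (s : seq I) (Q : pred I) (F : I -> K) :
  phi (\sum_(i <- s | Q i) F i) = \sum_(i <- s | Q i) phi (F i).
Proof. exact: (big_morph phi klinearD klinear0). Qed.

Lemma klinear_mulmx m n p (Y : 'M[K]_(m, n)) (A : 'M[k]_(n, p)) :
  map_mx phi (Y *m map_mx iota A) = map_mx phi Y *m A.
Proof.
apply/matrixP => i j; rewrite !mxE klinear_sum; apply: eq_bigr => l _.
by rewrite !mxE klinearM.
Qed.

Lemma klinear_tr n (Y : 'M[K]_n) : phi (\tr Y) = \tr (map_mx phi Y).
Proof. by rewrite /mxtrace klinear_sum; apply: eq_bigr => i _; rewrite mxE. Qed.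

Lemma klinear_mulmxl m n p (A : 'M[k]_(m, n)) (Y : 'M[K]_(n, p)) :
  map_mx phi (map_mx iota A *m Y) = A *m map_mx phi Y.
Proof.
apply/matrixP => i j; rewrite !mxE klinear_sum; apply: eq_bigr => l _.
by rewrite !mxE mulrC klinearM mulrC.
Qed.

End KLinear.

Lemma klinear_separates m n (Y : 'M[K]_(m, n)) :
  (forall phi, klinear phi -> map_mx phi Y = 0) -> Y = 0.
Proof.
move=> Y0; apply/matrixP => i j; rewrite mxE; apply: contrapT => /eqP Yij.
have [phi phiL phi1] := klinear_exists Yij.
have /matrixP/(_ i j) := Y0 phi phiL; rewrite !mxE phi1.
by apply/eqP; rewrite oner_eq0.
Qed.

End Functionals.

(** * Density of points over k and descent *)

Section RationalPoints.
Variables (k K : fieldType) (iota : {rmorphism k -> K}) (n : nat).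
Hypothesis kinf : infinite_set [set: k].
Local Notation PGL := (PGL K n.+1).

Lemma poly_eq0_iota (p : {poly K}) : (forall c, p.[iota c] = 0) -> p = 0.
Proof.
move=> pc; apply: contrapT => /eqP p0.
have [s us ss] := infinite_uniq_seq kinf (size p).
have rs : all (root p) (map iota s).
  by apply/allP => _ /mapP[c _ ->]; rewrite rootE pc.
have := max_poly_roots p0 rs.
by rewrite map_inj_uniq ?us; [move=> /(_ isT); rewrite size_map ss ltnn | apply: fmorph_inj].
Qed.

(** Density of the points over [k] in a linear space: coefficients are freed one at a time, since a
    polynomial in one variable that vanishes on the infinite field [k] is zero. *)
Lemma hpoly_eq0_iota m (I : eqType) (s : seq I) (B : I -> 'M[K]_m) d f M0 :
  uniq s -> hpoly d f ->
  (forall x : I -> k, f (M0 + \sum_(i <- s) iota (x i) *: B i) = 0) ->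
  forall y : I -> K, f (M0 + \sum_(i <- s) y i *: B i) = 0.
Proof.
move=> us hf; elim: s us M0 => [_|i s IHs /= /andP[nis us]] M0 f0 y.
  by have := f0 (fun=> 0); rewrite !big_nil.
rewrite big_cons addrA; apply: IHs => // x.
have [p pE] := hpoly_line (M0 + \sum_(j <- s) iota (x j) *: B j) (B i) hf.
rewrite addrAC pE (@poly_eq0_iota p) ?horner0 // => c; rewrite -pE.
have := f0 (fun j => if j == i then c else x j).
rewrite big_cons eqxx [_ *: _ + _]addrC addrA.
congr (f (_ + _ + _) = 0); apply: eq_big_seq => j js.
by case: eqP nis => // <-; rewrite js.
Qed.

Lemma map_gl_subproof (A : GL k n.+1) : map_mx iota (val A) \in unitmx.
Proof. by rewrite map_unitmx; apply: valP. Qed.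

Definition map_gl (A : GL k n.+1) : GL K n.+1 := mkGL (map_gl_subproof A).

(** Multiplying the numerator by the determinant makes it vanish at the singular matrices over [k]
    too, so that density in all matrices applies. *)
Lemma regular_eq0 (F : PGL -> K) : regular F ->
  (forall A, F (\pi_PGL (map_gl A)) = 0) -> forall x, F x = 0.
Proof.
move=> /regularP[d [f [hf Ff]]] F0 x; have [g ->] := pglP x.
have hdet := hpoly_det (@hpoly_mx_id K n.+1).
have hfd := hpolyM hf hdet.
pose B (ij : 'I_n.+1 * 'I_n.+1) : 'M[K]_n.+1 := delta_mx ij.1 ij.2.
have sumB (X : 'M[K]_n.+1) : X = 0 + \sum_ij X ij.1 ij.2 *: B ij.
  by rewrite add0r [LHS]matrix_sum_delta pair_bigA.
have fd0 : f (val g) * \det (val g) = 0.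
  rewrite (sumB (val g)).
  apply: (hpoly_eq0_iota (B := B) (M0 := 0) (index_enum_uniq _) hfd) => y.
  pose A : 'M[k]_n.+1 := \matrix_(i, j) y (i, j).
  have <- : map_mx iota A = 0 + \sum_ij iota (y ij) *: B ij.
    by rewrite [LHS]sumB; congr (_ + _); apply: eq_bigr => -[i j] _; rewrite !mxE.
  have [Au|nAu] := boolP (A \in unitmx); last first.
    rewrite det_map_mx; move: nAu; rewrite unitmxE unitfE negbK => /eqP ->.
    by rewrite rmorph0 mulr0.
  have /eqP := F0 (mkGL Au); rewrite Ff mulf_eq0 invr_eq0 expf_eq0.
  rewrite (negbTE (gl_det_neq0 (map_gl (mkGL Au)))) andbF orbF => /eqP /= ->.
  by rewrite mul0r.
move/eqP: fd0; rewrite mulf_eq0 (negbTE (gl_det_neq0 g)) orbF Ff => /eqP ->.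
by rewrite mul0r.
Qed.

Lemma mcoeff_map_iota l (p : {mpoly k[l]}) m : (map_mpoly iota p)@_m = iota p@_m.
Proof. exact: mcoeff_map_mpoly. Qed.

Lemma mx_eval_map (f : {mpoly k[(n.+1 * n.+1)%N]}) (A : 'M[k]_n.+1) :
  mx_eval (map_mpoly iota f) (map_mx iota A) = iota (mx_eval f A).
Proof.
rewrite /mx_eval !mevalE (perm_big _ (msupp_map_mpoly _ (fmorph_inj iota))) rmorph_sum.
apply: eq_bigr => m _; rewrite mcoeff_map_iota rmorphM rmorph_prod /=.
by congr (_ * _); apply: eq_bigr => i _; rewrite -map_mxvec mxE rmorphXn.
Qed.

Lemma regular_over_regular (F : PGL -> K) : regular_over iota F -> regular F.
Proof.
move=> [d [f [fh Ff]]]; exists d, (map_mpoly iota f); split=> //.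
apply/dhomogP => m; rewrite mcoeff_msupp mcoeff_map_iota => fm.
apply: (dhomogP _ _ _ fh); rewrite mcoeff_msupp.
by apply: contraNneq fm => ->; rewrite rmorph0.
Qed.

Lemma regular_over_map_gl (F : PGL -> K) A :
  regular_over iota F -> exists c, F (\pi_PGL (map_gl A)) = iota c.
Proof.
move=> [d [f [fh ->]]]; exists (mx_eval f (val A) / \det (val A) ^+ d).
by rewrite /det_frac /= mx_eval_map det_map_mx fmorph_div rmorphXn.
Qed.

(** The function built from [Y] is a sum of terms [c l * F l] with [F l] over [k] and zero on [P].
    At points over [k], applying [phi] turns it into the function of [phi Y] and each [c l] into
    [phi (c l)]; density extends the identity to all points. *)
Lemma defined_over_form (P : set PGL) phi (Y : 'M[K]_n.+1) :
  klinear iota phi -> defined_over iota P ->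
  (forall g, P (\pi_PGL g) -> \tr (Y *m val g) = 0) ->
  forall g, P (\pi_PGL g) -> \tr (map_mx iota (map_mx phi Y) *m val g) = 0.
Proof.
move=> phiL [_ Pdef] YP g Pg; have [i [j gij]] := gl_entry_neq0 g.
have [|x Px|m [c [F [FP FE]]]] := Pdef (frac 1 (form_entry Y i j)).
- exact/regular_frac/hpoly_form_entry.
- have [h hx] := pglP x; rewrite hx in Px *.
  by rewrite frac_form_entry YP // !mul0r.
set Y' := map_mx iota (map_mx phi Y).
have G0 : forall x, frac 1 (form_entry Y' i j) x +
    \sum_(l < m) (- iota (phi (c l))) * F l x = 0.
  apply: regular_eq0 => [|A].
    apply: regularD; first exact/regular_frac/hpoly_form_entry.
    apply: regular_sum => l; apply: regularZ.
    by apply: regular_over_regular; case: (FP l).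
  have Fl l := regular_over_map_gl A (proj1 (FP l)).
  have [a aE] := choice Fl.
  have := congr1 phi (FE (\pi_PGL (map_gl A))).
  rewrite !frac_form_entry (klinear_sum phiL) //= !mxE -rmorphXn det_map_mx.
  rewrite -!fmorphV !(klinearM phiL) (klinear_tr phiL) (klinear_mulmx phiL).
  move=> /(congr1 iota); rewrite !rmorphM /= => e.
  rewrite /Y' -map_mxM trace_map_mx e rmorph_sum -big_split big1 //= => l _.
  by rewrite aE (klinearM phiL) rmorphM mulNr subrr.
have := G0 (\pi_PGL g); rewrite big1 => [|l _]; last by have [_ ->] := FP l; rewrite ?mulr0.
rewrite addr0 frac_form_entry => /eqP.
rewrite !mulf_eq0 invr_eq0 (negbTE (gl_det_neq0 g)) orbF.
by rewrite expf_eq0 (negbTE gij) andbF orbF => /eqP.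
Qed.

(** Applying a functional to the coefficients of a polynomial that vanishes on the units of [A]
    gives one over [k] that vanishes there too: first at matrices over [k], then everywhere, as
    these span [A]. *)
Lemma pset_defined_over (A : set 'M[K]_n.+1) (I : finType) (B : I -> 'M[k]_n.+1) :
  lin_closed A -> closed (pset A) ->
  (forall X, A X <-> exists y : I -> K, X = \sum_i y i *: map_mx iota (B i)) ->
  defined_over iota (pset A).
Proof.
move=> linA clA AE; split=> // F [d [f [fh Ff]]] F0.
pose van (p : {mpoly K[(n.+1 * n.+1)%N]}) :=
  forall X, A X -> X \in unitmx -> mx_eval p X = 0.
have vanf : van f.
  move=> X AX Xu; have : F (\pi_PGL (mkGL Xu)) = 0 by apply: F0; apply/pset_pi.
  move/eqP; rewrite Ff /det_frac mulf_eq0 invr_eq0 expf_eq0.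
  by rewrite (negbTE (gl_det_neq0 (mkGL Xu))) andbF orbF => /eqP.
have hom_map (p : {mpoly k[(n.+1 * n.+1)%N]}) e :
    p \is e.-homog -> map_mpoly iota p \is e.-homog.
  move=> ph; apply/dhomogP => m; rewrite mcoeff_msupp mcoeff_map_iota => pm.
  apply: (dhomogP _ _ _ ph); rewrite mcoeff_msupp.
  by apply: contraNneq pm => ->; rewrite rmorph0.
have dec N (p : {mpoly K[(n.+1 * n.+1)%N]}) : (size (msupp p) <= N)%N ->
    p \is (n.+1 * d)%N.-homog -> van p ->
    exists s : seq (K * {mpoly k[(n.+1 * n.+1)%N]}),
      p = \sum_(x <- s) x.1 *: map_mpoly iota x.2 /\
      forall x, x \in s -> x.2 \is (n.+1 * d)%N.-homog /\ van (map_mpoly iota x.2).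
  elim: N p => [|N IHN] p.
    by rewrite leqn0 size_eq0 msupp_eq0 => /eqP -> _ _; exists [::]; rewrite big_nil.
  move=> sp ph vp; have [p0|p0] := eqVneq p 0.
    by exists [::]; rewrite big_nil p0.
  have mp := mlead_supp p0; set m0 := mlead p in mp.
  have u0 : p@_m0 != 0 by rewrite -mcoeff_msupp.
  (* As [phi] is 1 on the leading coefficient, subtracting that multiple of [q] removes [m0] from
     the support and adds no monomial, so induction on its size proceeds. *)
  have [phi phiL phi1] := klinear_exists iota u0.
  pose q := \sum_(m <- msupp p) phi p@_m *: 'X_[m] : {mpoly k[(n.+1 * n.+1)%N]}.
  have qm m : q@_m = phi p@_m.
    rewrite raddf_sum /=; have [mp'|mp'] := boolP (m \in msupp p).
      rewrite (bigD1_seq m) ?msupp_uniq //= mcoeffZ mcoeffX eqxx mulr1.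
      rewrite big1 ?addr0 // => m' m'm.
      by rewrite mcoeffZ mcoeffX (negbTE m'm) mulr0.
    rewrite memN_msupp_eq0 // (klinear0 phiL) big_seq big1 // => m' m'p.
    rewrite mcoeffZ mcoeffX; case: eqP m'p => [->|]; first by rewrite (negbTE mp').
    by rewrite mulr0.
  have qh : q \is (n.+1 * d)%N.-homog.
    apply/dhomogP => m; rewrite mcoeff_msupp qm => qm0.
    apply: (dhomogP _ _ _ ph); rewrite mcoeff_msupp.
    by apply: contraNneq qm0 => ->; rewrite (klinear0 phiL).
  have q_eval (X : 'M[k]_n.+1) : mx_eval q X = phi (mx_eval p (map_mx iota X)).
    rewrite /mx_eval /q raddf_sum mevalE (klinear_sum phiL) //=; apply: eq_bigr => m _.
    rewrite mevalZ mevalX -(klinearM phiL) rmorph_prod; congr (phi (_ * _)).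
    by apply: eq_bigr => i _; rewrite -map_mxvec mxE rmorphXn.
  have vq : van (map_mpoly iota q).
    move=> X AX Xu; have [y yE] := (AE X).1 AX.
    have hq : hpoly (n.+1 * d) (mx_eval (map_mpoly iota q)).
      by exists (map_mpoly iota q) => //; apply: hom_map.
    have hqd := hpolyM hq (hpoly_det (@hpoly_mx_id K n.+1)).
    (* The determinant takes care of the singular matrices over [k]. *)
    have : mx_eval (map_mpoly iota q) X * \det X = 0.
      rewrite yE -[\sum_i _]add0r.
      apply: (hpoly_eq0_iota (B := fun i => map_mx iota (B i)) (M0 := 0)
        (index_enum_uniq _) hqd) => x; rewrite add0r.
      have -> : \sum_i iota (x i) *: map_mx iota (B i) = map_mx iota (\sum_i x i *: B i).
        by rewrite raddf_sum; apply: eq_bigr => i _; rewrite /= map_mxZ.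
      set X0 := \sum_i _; rewrite mx_eval_map q_eval det_map_mx.
      have [X0u|] := boolP (X0 \in unitmx).
        rewrite vp ?map_unitmx // ?(klinear0 phiL) ?rmorph0 ?mul0r //.
        apply/AE; exists (iota \o x); rewrite raddf_sum.
        by apply: eq_bigr => i _; rewrite /= map_mxZ.
      by rewrite unitmxE unitfE negbK => /eqP ->; rewrite rmorph0 mulr0.
    by move/eqP; rewrite mulf_eq0; move: Xu; rewrite unitmxE unitfE => /negbTE -> /[!orbF] /eqP.
  have [||| s [sE sP]] := IHN (p - p@_m0 *: map_mpoly iota q).
  - rewrite -ltnS; apply: leq_trans sp; rewrite (perm_size (perm_to_rem mp)) /= ltnS.
    apply: uniq_leq_size; first exact: msupp_uniq.
    move=> m; rewrite mcoeff_msupp mcoeffB mcoeffZ mcoeff_map_iota qm => pm.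
    rewrite mem_rem_uniq ?msupp_uniq // !inE mcoeff_msupp; apply/andP; split.
      by apply: contraNneq pm => ->; rewrite phi1 (rmorph1 iota) mulr1 subrr.
    by apply: contraNneq pm => ->; rewrite (klinear0 phiL) (rmorph0 iota) mulr0 subrr.
  - by apply: rpredB => //; apply: rpredZ; apply: hom_map.
  - move=> X AX Xu; rewrite /mx_eval mevalB mevalZ.
    by have := vp X AX Xu; have := vq X AX Xu; rewrite /mx_eval => -> ->; rewrite mulr0 subrr.
  exists ((p@_m0, q) :: s); rewrite big_cons -sE /= addrCA subrr addr0; split=> // x.
  by rewrite inE => /orP[/eqP -> //|/sP].
have [s [sE sP]] := dec _ f (leqnn _) fh vanf.
have sPi (i : 'I_(size s)) : (tnth (in_tuple s) i).2 \is (n.+1 * d)%N.-homog /\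
    van (map_mpoly iota (tnth (in_tuple s) i).2).
  by apply: sP; rewrite (tnth_nth (0, 0)) mem_nth.
exists (size s), (fun i => (tnth (in_tuple s) i).1),
  (fun i => frac d (mx_eval (map_mpoly iota (tnth (in_tuple s) i).2))).
have hs i : hpoly (n.+1 * d) (mx_eval (map_mpoly iota (tnth (in_tuple s) i).2)).
  exists (map_mpoly iota (tnth (in_tuple s) i).2) => //; apply: hom_map.
  by case: (sPi i).
split=> [i|x].
  have [ih iv] := sPi i; split=> [|x].
    by exists d, (tnth (in_tuple s) i).2; split=> // g; rewrite frac_pi.
  have [g ->] := pglP x => /(pset_pi g linA) Ag.
  by rewrite frac_pi // iv ?mul0r //; apply: valP.
have [g ->] := pglP x; rewrite Ff /det_frac {1}sE /mx_eval.
rewrite (big_morph _ (mevalD _) (meval0 _)) mulr_suml.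
rewrite (big_tnth _ _ s); apply: eq_bigr => i _.
by rewrite (frac_pi _ (hs i)) mevalZ mulrA.
Qed.

End RationalPoints.

Section UnitsOfAlgebras.
Variables (K : fieldType) (n : nat).
Hypothesis Kinf : infinite_set [set: K].

(** The algebra is spanned by its units: for each [X] some [1 + t X] with nonzero [t] is
    invertible. *)
Lemma form_eq0_units (A : set 'M[K]_n.+1) (Y : 'M[K]_n.+1) :
  lin_closed A -> A 1%:M ->
  (forall X, A X -> X \in unitmx -> \tr (Y *m X) = 0) ->
  forall X, A X -> \tr (Y *m X) = 0.
Proof.
move=> linA A1 AY X AX.
have [p pE] := hpoly_line 1%:M X (hpoly_det (@hpoly_mx_id K n.+1)).
have p0 : p != 0.
  apply/eqP => p0; have := pE 0.
  by rewrite scale0r addr0 det1 p0 horner0; apply/eqP; rewrite oner_eq0.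
have [t] := poly_nonroot Kinf (mulf_neq0 p0 (monic_neq0 (monicX K))).
rewrite hornerM hornerX mulf_eq0 negb_or -pE => /andP[dt t0].
have Y1 : \tr (Y *m 1%:M) = 0 by apply: AY; rewrite ?unitmx1.
have : \tr (Y *m (1%:M + t *: X)) = 0.
  apply: AY; last by rewrite unitmxE unitfE.
  by rewrite addrC; case: linA => _; apply.
rewrite mulmxDr mxtraceD Y1 add0r -scalemxAr mxtraceZ => /eqP.
by rewrite mulf_eq0 (negbTE t0) => /eqP.
Qed.

End UnitsOfAlgebras.

(** * The subgroup and its overgroups *)

Section Companion.

(** On rows this is multiplication by T on F[T]/(T^4 - a) in the basis 1, T, T^2, T^3. *)
Definition companion (F : fieldType) (a : F) : 'M[F]_4 :=
  \matrix_(i, j) if i.+1 == j :> nat then 1 else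
                 if (i == 3 :> nat) && (j == 0 :> nat) then a else 0.

Variable F : fieldType.
Implicit Types (a mu : F) (v : 'rV[F]_4).

Definition o0 : 'I_4 := @Ordinal 4 0 isT.
Definition o1 : 'I_4 := @Ordinal 4 1 isT.
Definition o2 : 'I_4 := @Ordinal 4 2 isT.
Definition o3 : 'I_4 := @Ordinal 4 3 isT.

Lemma ord4P (P : 'I_4 -> Prop) : P o0 -> P o1 -> P o2 -> P o3 -> forall i, P i.
Proof.
move=> P0 P1 P2 P3 [[|[|[|[|//]]]] lt_i4].
- by rewrite (_ : Ordinal _ = o0) //; apply: val_inj.
- by rewrite (_ : Ordinal _ = o1) //; apply: val_inj.
- by rewrite (_ : Ordinal _ = o2) //; apply: val_inj.
- by rewrite (_ : Ordinal _ = o3) //; apply: val_inj.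
Qed.

Lemma sum4 (V : nmodType) (f : 'I_4 -> V) :
  \sum_i f i = f o0 + (f o1 + (f o2 + f o3)).
Proof.
rewrite !big_ord_recl big_ord0 addr0.
by do ![congr (_ + _)]; congr f; apply: val_inj.
Qed.

Lemma mul_companion a m (X : 'M[F]_(m, 4)) i : [/\
  (X *m companion a) i o0 = X i o3 * a, (X *m companion a) i o1 = X i o0,
  (X *m companion a) i o2 = X i o1 & (X *m companion a) i o3 = X i o2].
Proof.
by split; rewrite mxE sum4 !mxE /= ?(mulr0, mulr1, add0r, addr0).
Qed.

Lemma companion_unit a : a != 0 -> companion a \in unitmx.
Proof.
move=> a0; rewrite unitmxE unitfE; apply/det0P => -[v v0 vN].
have [] := mul_companion a v 0; rewrite vN !mxE => e0 e1 e2 e3.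
move/eqP: v0; apply; apply/rowP; apply: ord4P; rewrite mxE //.
by apply/eqP; move/esym/eqP: e0; rewrite mulf_eq0 (negbTE a0) orbF.
Qed.

(** Each coordinate is [mu] times the next, so the last one determines the vector; the wrap-around
    gives [mu ^+ 4 = a]. *)
Lemma companion_eigenvector a mu v : v *m companion a = mu *: v -> v != 0 ->
  [/\ mu ^+ 4 = a, v 0 o3 != 0 &
     v = v 0 o3 *: \row_j mu ^+ (3 - j)].
Proof.
have [e0 e1 e2 e3] := mul_companion a v 0.
move=> vN v0; rewrite vN !mxE in e0 e1 e2 e3.
have vE : v = v 0 o3 *: \row_j mu ^+ (3 - j).
  by apply/rowP; apply: ord4P; rewrite !mxE /= -?e1 -?e2 -?e3; ring.
have v3 : v 0 o3 != 0 by apply: contraNneq v0 => v3; rewrite vE v3 scale0r.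
split=> //; apply: (mulfI v3); by rewrite -e0 -e1 -e2 -e3; ring.
Qed.

Lemma row_companionX a (j : 'I_4) :
  (delta_mx 0 o0 : 'rV_4) *m companion a ^+ j = delta_mx 0 j.
Proof.
have step (i j' : 'I_4) : i.+1 = j' :> nat ->
    (delta_mx 0 i : 'rV_4) *m companion a = delta_mx 0 j'.
  move=> ij; rewrite -rowE; apply/rowP => l; rewrite !mxE eqxx /= ij.
  rewrite -val_eqE [_ == l :> nat]eq_sym; case: eqP => //= _; case: ifP => // /andP[/eqP i3].
  by have := ltn_ord j'; rewrite -ij i3.
move: j; apply: ord4P => /=; first by rewrite expr0 mulmx1.
- by rewrite expr1; apply: step.
- by rewrite exprSr expr1 mulmxA (step o0 o1) // (step o1 o2).
- by rewrite !exprSr expr0 mul1r !mulmxA (step o0 o1) // (step o1 o2) // (step o2 o3).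
Qed.

(** The first basis row is a cyclic vector, so [X] is determined by its first row, whose entries are
    the coefficients sought. *)
Lemma centralizer_companion a (X : 'M[F]_4) :
  X *m companion a = companion a *m X <->
  exists y : 'I_4 -> F, X = \sum_i y i *: companion a ^+ i.
Proof.
set N := companion a; split=> [XN|[y ->]]; last first.
  rewrite mulmx_suml mulmx_sumr; apply: eq_bigr => i _.
  by rewrite -scalemxAl -scalemxAr -[_ *m N]exprSr -[N *m _]exprS.
have XNj j : X *m N ^+ j = N ^+ j *m X.
  elim: j => [|j IHj]; first by rewrite expr0 mulmx1 mul1mx.
  by rewrite exprS mulmxA XN -mulmxA IHj mulmxA.
exists (X o0); apply/row_matrixP => j.
rewrite rowE -(row_companionX a) -/N -mulmxA -XNj mulmxA -rowE.
rewrite [in RHS]rowE -(row_companionX a) -/N -mulmxA mulmx_sumr mulmx_sumr.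
rewrite [row o0 X]matrix_sum_delta big_ord1 mulmx_suml; apply: eq_bigr => i _.
rewrite mxE -!scalemxAr -scalemxAl -(row_companionX a i) -/N -!mulmxA.
by congr (_ *: (_ *m _)); rewrite -[LHS]exprD addnC exprD.
Qed.

Lemma map_companion (L : fieldType) (f : {rmorphism F -> L}) a :
  map_mx f (companion a) = companion (f a).
Proof.
apply/matrixP => i j; rewrite !mxE; case: ifP => _; first exact: rmorph1.
by case: ifP => // _; apply: rmorph0.
Qed.

Definition companion_centralizer a : set 'M[F]_4 :=
  [set X | X *m companion a = companion a *m X].

Lemma centralizer_subalgebra a : subalgebra (companion_centralizer a).
Proof.
split=> [||X Y XN YN]; last 2 first.
- by rewrite /companion_centralizer /= mulmx1 mul1mx.
- by rewrite /companion_centralizer /= -mulmxA YN mulmxA XN mulmxA.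
split=> [|c X Y XN YN]; first by rewrite /companion_centralizer /= mulmx0 mul0mx.
by rewrite /companion_centralizer /= mulmxDl mulmxDr -scalemxAl -scalemxAr XN YN.
Qed.

(** The trace form moves the commutator with [N] from one factor to the other. *)
Lemma centralizer_ann a : companion_centralizer a =
  ann [set companion a *m Y - Y *m companion a | Y in setT].
Proof.
set N := companion a.
have trE X Y : \tr ((N *m Y - Y *m N) *m X) = \tr (Y *m (X *m N - N *m X)).
  by rewrite mulmxBl mulmxBr !raddfB /= -mulmxA mxtrace_mulC !mulmxA.
apply/seteqP; split=> [X XN _ [Y _ <-]|X SX].
  by rewrite trE XN subrr mulmx0 mxtrace0.
apply/eqP; rewrite -subr_eq0; apply/eqP/matrixP => p q.
by rewrite -mxtrace_delta -trE mxE; apply: SX; exists (delta_mx q p).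
Qed.

End Companion.

(** * The group H and its irreducibility over k *)

Section Irreducibility.
Variables (k : fieldType) (K : closedFieldType) (iota : {rmorphism k -> K}).
Hypotheses (char2 : 2%N \in [pchar k]) (kinf : infinite_set [set: k]).
Variables (a : k) (b : K).
Hypotheses (a_nonsquare : forall c, c ^+ 2 != a) (b4 : b ^+ 4 = iota a).
Local Notation N := (companion (iota a)).
Local Notation GL := (GL K 4).
Local Notation PGL := (PGL K 4).

Lemma charK2 : 2%N \in [pchar K].
Proof. exact: rmorph_pchar char2. Qed.

Lemma sqrD2 (R : comNzRingType) : 2%N \in [pchar R] ->
  forall x y : R, (x + y) ^+ 2 = x ^+ 2 + y ^+ 2.
Proof.
move=> R2 x y; rewrite sqrrD -mulr_natr (_ : 2%:R = 0) ?mulr0 ?addr0 //.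
by case/andP: R2 => _ /eqP.
Qed.

Lemma a_neq0 : iota a != 0.
Proof. by rewrite fmorph_eq0; have := a_nonsquare 0; rewrite expr0n eq_sym. Qed.

Lemma K_infinite : infinite_set [set: K].
Proof.
move=> finK; apply: kinf.
have : finite_set (iota @^-1` [set: K]) by apply: finite_preimage => // x y _ _ /fmorph_inj.
by rewrite preimage_setT.
Qed.

(** In characteristic 2 a nontrivial zero would make [a] the square of [p / q]. *)
Lemma sum_squares_eq0 (p q : k) : p ^+ 2 + a * q ^+ 2 = 0 -> p = 0 /\ q = 0.
Proof.
move=> pq; have q0 : q = 0.
  apply: contrapT => /eqP q0; have := a_nonsquare (p / q); apply/negP; rewrite negbK.
  rewrite expr_div_n (_ : p ^+ 2 = a * q ^+ 2) ?mulfK ?expf_neq0 //.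
  by apply/eqP; rewrite -subr_eq0 oppr_pchar2 // pq.
split=> //; move: pq; rewrite q0 expr0n mulr0 addr0 => /eqP.
by rewrite expf_eq0 => /eqP.
Qed.

(** The fourth power is additive, and that of the relation is a nested sum of squares over [k], to
    which [sum_squares_eq0] applies twice. *)
Lemma powers_independent (x : 'I_4 -> k) :
  \sum_(j < 4) b ^+ (3 - j) * iota (x j) = 0 -> forall j, x j = 0.
Proof.
rewrite sum4 /= => s0.
have : (x o3 ^+ 2 + a * x o1 ^+ 2) ^+ 2 + a * (x o2 ^+ 2 + a * x o0 ^+ 2) ^+ 2 = 0.
  apply: (fmorph_inj iota); rewrite rmorph0.
  have := congr1 (fun z => (z ^+ 2) ^+ 2) s0.
  rewrite /= !expr0n /= !(sqrD2 charK2) => e; rewrite -[RHS]e.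
  rewrite !(rmorphD, rmorphM, rmorphXn) /= -b4 !(sqrD2 charK2).
  by ring.
move/sum_squares_eq0 => [/sum_squares_eq0[x3 x1] /sum_squares_eq0[x2 x0]].
exact: ord4P.
Qed.

Local Notation socle := (\row_(j < 4) b ^+ (3 - j)).

Lemma socle_mul_eq0 (X : 'M[k]_4) : socle *m map_mx iota X = 0 -> X = 0.
Proof.
move=> sX; apply/matrixP => i j; rewrite mxE; move: i; apply: powers_independent.
have /rowP/(_ j) := sX; rewrite !mxE => e; rewrite -[RHS]e.
by apply: eq_bigr => i _; rewrite !mxE.
Qed.

Lemma fourth_root_unique mu : mu ^+ 4 = iota a -> mu = b.
Proof.
move=> mu4; apply/eqP; rewrite -subr_eq0.
suff : (mu - b) ^+ 4 == 0 by rewrite expf_eq0.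
by rewrite (exprM _ 2 2) oppr_pchar2 ?charK2 // !(sqrD2 charK2) -!exprM mu4 b4
  addrr_pchar2 ?charK2.
Qed.

(* The rows [w] with [w N^i X = 0] for all [i] form an [N]-stable space, and the
   only eigenline of [N] is spanned by [socle]. *)
Lemma cyclic_mul_eq0 (X : 'M[k]_4) (y : 'rV[K]_4) : y != 0 ->
  (forall i, y *m N ^+ i *m map_mx iota X = 0) -> X = 0.
Proof.
move=> y0 yX.
pose W := [set w : 'rV[K]_4 | forall i, w *m N ^+ i *m map_mx iota X = 0].
have linW : lin_closed W.
  split=> [i|c v w Wv Ww i]; first by rewrite !mul0mx.
  by rewrite !mulmxDl -!scalemxAl Wv Ww scaler0 addr0.
have WN v : W v -> W (v *m N).
  by move=> Wv i; rewrite -(mulmxA v) -[N *m _]exprS; apply: Wv.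
have nUy : ~ rowspace (0 : 'M[K]_4) y.
  by rewrite /rowspace /= submx0; apply/negP.
have [v [mu [Wv nUv]]] := eigenvector_mod linW WN yX nUy.
rewrite /rowspace /= submx0 subr_eq0 => /eqP vN.
have v0 : v != 0 by apply/eqP => v0; apply: nUv; rewrite /rowspace /= v0 sub0mx.
have [/fourth_root_unique mub v3 vE] := companion_eigenvector vN v0.
apply: socle_mul_eq0; rewrite -mub; have := Wv 0%N; rewrite expr0 mulmx1 vE.
by rewrite -scalemxAl => /eqP; rewrite scaler_eq0 (negbTE v3) => /eqP.
Qed.

Definition field_torus : set PGL := pset (companion_centralizer (iota a)).

Lemma field_torusP (g : GL) : field_torus (\pi_PGL g) <-> val g *m N = N *m val g.
Proof. by apply: pset_pi; case: (centralizer_subalgebra (iota a)). Qed.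

Lemma field_torus_closed_subgroup : closed_subgroup field_torus.
Proof.
split; first exact/pset_subgroup/centralizer_subalgebra.
by rewrite /field_torus centralizer_ann; apply: pset_ann_closed.
Qed.

Lemma field_torus_connected : connected field_torus.
Proof.
apply: pset_connected; first exact: K_infinite.
by case: (centralizer_subalgebra (iota a)).
Qed.

Lemma field_torus_defined_over : defined_over iota field_torus.
Proof.
apply: (pset_defined_over kinf (B := fun i : 'I_4 => companion a ^+ i)).
- by case: (centralizer_subalgebra (iota a)).
- by case: field_torus_closed_subgroup.
move=> X; rewrite /companion_centralizer /= centralizer_companion.
have powN (i : 'I_4) : map_mx iota (companion a ^+ i) = N ^+ i.
  by rewrite rmorphXn /= map_companion.
by split=> -[y ->]; exists y; apply: eq_bigr => i _; rewrite powN.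
Qed.

(** A nonzero corner entry would let [unitmx_mem] show that the conjugated preimage of [P] contains
    every invertible matrix. *)
Lemma parabolic_corner (P : set PGL) (Q : 'M[K]_4) : Q \in unitmx ->
  subgroup P -> flag_group Q `<=` P -> P <> setT ->
  forall g, P (\pi_PGL g) -> (Q *m val g *m invmx Q) 0 ord_max = 0.
Proof.
move=> Qu sP QP PT g Pg; apply: contrapT => /eqP corner; apply: PT.
pose M := [set X : 'M[K]_4 | exists2 h : GL, P (\pi_PGL h) & X = Q *m val h *m invmx Q].
have unitQ (h : GL) : Q *m val h *m invmx Q \in unitmx.
  by rewrite !unitmx_mul Qu unitmx_inv Qu (valP h).
have Munit X : M X -> X \in unitmx by move=> [h _ ->]; apply: unitQ.
have Mmul X Y : M X -> M Y -> M (X *m Y).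
  move=> [h Ph ->] [h' Ph' ->]; exists (h * h')%g.
    by rewrite pgl_piM; apply: subgroupM.
  by rewrite !mulmxA mulmxKV.
have Minv X : M X -> M (invmx X).
  move=> [h Ph ->]; exists (h^-1)%g; first by rewrite pgl_piV; apply: subgroupV.
  have e : Q *m val h *m invmx Q *m (Q *m val (h^-1)%g *m invmx Q) = 1%:M.
    by rewrite !mulmxA mulmxKV // -(mulmxA Q) -val_glM mulgV mulmx1 mulmxV.
  by rewrite -[RHS](mulKmx (unitQ h)) e mulmx1.
have Mlow X : X \in unitmx -> low 0 X -> M X.
  move=> Xu Xl; have Vu : invmx Q *m X *m Q \in unitmx.
    by rewrite !unitmx_mul unitmx_inv Qu Xu.
  have e : X = Q *m val (mkGL Vu) *m invmx Q by rewrite /= !mulmxA mulmxV // mul1mx mulmxK.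
  exists (mkGL Vu) => //; apply/QP/flag_groupP => //.
  by rewrite -e -low_trig.
have Mg : M (Q *m val g *m invmx Q) by exists g.
apply/seteqP; split=> // x _; have [h ->] := pglP x.
have [h' Ph' /(congr1 (fun X => invmx Q *m X *m Q))] :=
  unitmx_mem Munit Mmul Minv Mlow Mg corner (unitQ h).
rewrite !mulmxA mulVmx // !mul1mx !mulmxKV // => e.
by rewrite (_ : h = h') //; apply: val_inj.
Qed.

Lemma field_torus_irreducible : irreducible_over iota field_torus.
Proof.
move=> P [[sP cP] [B borB BP]] Pdef PT HP.
have [Q Qu BQ] := borel_flag_group K_infinite borB; rewrite BQ in BP.
have corner := parabolic_corner Qu sP BP PT.
(* The trace form of [Y] reads off the corner entry in the basis [Q]. *)
pose Y := invmx Q *m delta_mx ord_max 0 *m Q.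
have Y0 : Y != 0.
  apply/eqP => Y0; have := congr1 (fun X => Q *m X *m invmx Q) Y0.
  rewrite /Y !mulmxA mulmxV // mul1mx mulmxK // mulmx0 mul0mx.
  by move/matrixP/(_ ord_max 0); rewrite !mxE !eqxx; apply/eqP; rewrite oner_eq0.
have YP g : P (\pi_PGL g) -> \tr (Y *m val g) = 0.
  by move=> Pg; rewrite conjset_entry corner.
move/eqP: Y0; apply; apply: (klinear_separates (iota := iota)) => phi phiL.
have XP := defined_over_form kinf phiL Pdef YP.
move: (map_mx phi Y) XP => X XP.
have Nu i : N ^+ i \in unitmx by apply/unitrX/companion_unit/a_neq0.
apply: (@cyclic_mul_eq0 _ (row 0 Q)) => [|i].
  apply: contraTneq Qu => Q0; rewrite -row_free_unit; apply/negP => /row_freeP[Q' QQ'].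
  have := congr1 (row 0) QQ'; rewrite row_mul Q0 mul0mx.
  by move/rowP/(_ 0); rewrite !mxE eqxx => /esym/eqP; rewrite oner_eq0.
(* In the basis [Q], the form of [Z] takes a triangular [D] to the value of the form of [X] on a
   flag group element times [N ^+ i]. Both factors lie in [P], so it vanishes. *)
pose Z := Q *m (N ^+ i *m map_mx iota X) *m invmx Q.
have Zlow D : low 0 D -> \tr (Z *m D) = 0.
  move: D; apply: (form_eq0_units K_infinite (low_lin K 3 0)) => [|D Dl Du].
    exact: low_scalar.
  have Vu : invmx Q *m D *m Q \in unitmx by rewrite !unitmx_mul unitmx_inv Qu Du.
  have Pg : P (\pi_PGL (mkGL Vu)).
    apply/BP/flag_groupP => //=; rewrite !mulmxA mulmxV // mul1mx mulmxK //.
    exact/low_trig.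
  have PN : P (\pi_PGL (mkGL (Nu i))).
    by apply/HP/field_torusP; rewrite /= -[_ *m N]exprSr -[N *m _]exprS.
  have := XP (mkGL Vu * mkGL (Nu i))%g; rewrite pgl_piM => /(_ (subgroupM sP Pg PN)) /=.
  rewrite /Z => <-; rewrite -!mulmxA mxtrace_mulC -!mulmxA [LHS]mxtrace_mulC -!mulmxA.
  by [].
suff : row 0 Z = 0.
  rewrite /Z -!mulmxA row_mul !mulmxA => /(congr1 (mulmx^~ Q)).
  by rewrite mulmxKV // mul0mx.
(* The matrix units of the first column are lower triangular, and they read off the first row of
   [Z]. *)
apply/rowP => j; rewrite [LHS]mxE [RHS]mxE -mxtrace_delta mxtrace_mulC; apply: Zlow.
move=> p q; rewrite addn0 => pq; rewrite mxE -[q == 0]val_eqE /=.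
by rewrite gtn_eqF ?andbF // (leq_ltn_trans _ pq).
Qed.

End Irreducibility.

(** * A family of overgroups indexed by K *)

Section Overgroups.
Variables (k : fieldType) (K : closedFieldType) (iota : {rmorphism k -> K}).
Hypotheses (char2 : 2%N \in [pchar k]) (kinf : infinite_set [set: k]).
Variables (a : k) (b : K).
Hypotheses (a_nonsquare : forall c, c ^+ 2 != a) (b4 : b ^+ 4 = iota a).
Local Notation N := (companion (iota a)).
Local Notation GL := (GL K 4).
Local Notation PGL := (PGL K 4).

Lemma two_eq0 : 2%:R = 0 :> K.
Proof. by have /andP[_ /eqP] := charK2 iota char2. Qed.

(* With rows identified with polynomials in T modulo T^4 - a, where [N] is
   multiplication by T, the rows are (T - b)^3, (T - b)^2, T - b and 1. *)
Definition jordan_basis : 'M[K]_4 := \matrix_(i, j) nth 0 (nth [::]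
  [:: [:: b ^+ 3; b ^+ 2; b; 1]; [:: b ^+ 2; 0; 1; 0]; [:: b; 1; 0; 0]; [:: 1; 0; 0; 0]] i) j.

Definition jordan_inv : 'M[K]_4 := \matrix_(i, j) nth 0 (nth [::]
  [:: [:: 0; 0; 0; 1]; [:: 0; 0; 1; - b]; [:: 0; 1; 0; - b ^+ 2];
      [:: 1; - b; - b ^+ 2; b ^+ 3]] i) j.

Definition jordan_block : 'M[K]_4 := \matrix_(i, j)
  if i == j then b else if i == j.+1 :> nat then 1 else 0.

Local Notation R := jordan_basis.

Lemma jordan_basisK : R *m jordan_inv = 1%:M.
Proof.
apply/matrixP; apply: ord4P; apply: ord4P; rewrite mxE sum4 !mxE /=; ring.
Qed.

Lemma jordan_unit : R \in unitmx.
Proof. by case/mulmx1_unit: jordan_basisK. Qed.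

Lemma jordanE : R *m N *m invmx R = jordan_block.
Proof.
suff -> : R *m N = jordan_block *m R by rewrite mulmxK ?jordan_unit.
apply/matrixP => i j; have [e0 e1 e2 e3] := mul_companion (iota a) R i.
move: j; apply: ord4P; rewrite ?e0 ?e1 ?e2 ?e3; move: i {e0 e1 e2 e3};
  apply: ord4P; rewrite !mxE sum4 !mxE /= -?b4; ring: two_eq0.
Qed.

(** The Jordan block satisfies the last condition for every [al], since both sides contain
    [1 + 1 = 0]. *)
Definition jordan_core (al : K) : set 'M[K]_4 := [set Z | [/\ low 0 Z,
  forall i, Z i i = Z o0 o0 &
  Z o1 o0 + Z o2 o1 = al * (Z o2 o1 + Z o3 o2)]].

(** When diagonals are constant, the first subdiagonal of a product obeys the Leibniz rule, so a
    homogeneous linear condition on it passes to products. *)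
Lemma jordan_core_subalgebra al : subalgebra (jordan_core al).
Proof.
have lowE (Z T : 'M[K]_4) : low 0 Z -> low 0 T -> [/\
    forall i, (Z *m T) i i = Z i i * T i i,
    (Z *m T) o1 o0 = Z o1 o0 * T o0 o0 + Z o1 o1 * T o1 o0,
    (Z *m T) o2 o1 = Z o2 o1 * T o1 o1 + Z o2 o2 * T o2 o1 &
    (Z *m T) o3 o2 = Z o3 o2 * T o2 o2 + Z o3 o3 * T o3 o2].
  move=> Zl Tl; split; first apply: ord4P; rewrite mxE sum4;
  by rewrite ?(Zl o0 o1) ?(Zl o0 o2) ?(Zl o0 o3) ?(Zl o1 o2) ?(Zl o1 o3) ?(Zl o2 o3)
    ?(Tl o0 o1) ?(Tl o0 o2) ?(Tl o0 o3) ?(Tl o1 o2) ?(Tl o1 o3) ?(Tl o2 o3) //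
    ?(mul0r, mulr0, add0r, addr0).
split.
- split=> [|c Z T [Zl Zd Ze] [Tl Td Te]].
    by split=> [|i|]; [case: (low_lin K 3 0) | rewrite !mxE | rewrite !mxE; ring].
  split=> [|i|]; first by case: (low_lin K 3 0) => _; apply.
    by rewrite !mxE Zd Td.
  by rewrite !mxE addrACA -mulrDr Ze Te; ring.
- split=> [|i|]; [exact: low_scalar | by rewrite !mxE eqxx | by rewrite !mxE /=; ring].
move=> Z T [Zl Zd Ze] [Tl Td Te]; have [ZTd ZT1 ZT2 ZT3] := lowE _ _ Zl Tl.
split=> [|i|]; first by have := low_mul Zl Tl.
  by rewrite !ZTd Zd Td.
rewrite ZT1 ZT2 ZT3 !(Zd o1) !(Zd o2) !(Zd o3) !(Td o1) !(Td o2).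
rewrite addrACA -mulrDl -mulrDr Ze Te; ring.
Qed.

Definition overalgebra al : set 'M[K]_4 := conjset R (jordan_core al).

Lemma overalgebra_subalgebra al : subalgebra (overalgebra al).
Proof. exact: conjset_subalgebra jordan_unit (jordan_core_subalgebra al). Qed.

Lemma overalgebra_lin al : lin_closed (overalgebra al).
Proof. by case: (overalgebra_subalgebra al). Qed.

Definition perp (A : set 'M[K]_4) : set 'M[K]_4 :=
  [set Y | forall X, A X -> \tr (Y *m X) = 0].

(** Every defining condition is a trace form built from the [E p q], so the double annihilator adds
    nothing. This serves both closedness and descent. *)
Lemma overalgebra_ann al : overalgebra al = ann (perp (overalgebra al)).
Proof.
apply/seteqP; split=> [X AX Y|X SX]; first exact.
pose E p q := invmx R *m delta_mx q p *m R : 'M[K]_4.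
have trE p q Z : \tr (E p q *m Z) = (R *m Z *m invmx R) p q by exact: conjset_entry.
split=> [p q pq|i|].
- by rewrite -trE; apply: SX => Z [Zl _ _]; rewrite trE Zl.
- apply/eqP; rewrite -subr_eq0 -!trE -raddfB -mulmxBl; apply/eqP/SX => Z [_ Zd _].
  by rewrite mulmxBl raddfB /= !trE Zd subrr.
apply/eqP; rewrite -subr_eq0 -!trE.
have Etr Z : \tr ((E o1 o0 + E o2 o1 - al *: (E o2 o1 + E o3 o2)) *m Z) =
    \tr (E o1 o0 *m Z) + \tr (E o2 o1 *m Z) -
    al * (\tr (E o2 o1 *m Z) + \tr (E o3 o2 *m Z)).
  by rewrite mulmxBl -scalemxAl !mulmxDl raddfB /= mxtraceZ !mxtraceD.
by rewrite -Etr; apply/eqP/SX => Z [_ _ Ze]; rewrite Etr !trE Ze subrr.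
Qed.

Definition overgroup_of al : set PGL := pset (overalgebra al).

Lemma overgroup_of_overgroup al : overgroup (field_torus iota a) (overgroup_of al).
Proof.
split; first split.
- exact/pset_subgroup/overalgebra_subalgebra.
- by rewrite /overgroup_of overalgebra_ann; apply: pset_ann_closed.
move=> x; have [g ->] := pglP x => /field_torusP/centralizer_companion[y gy].
apply/pset_pi; first exact: overalgebra_lin.
rewrite gy; apply: lin_closed_sum => [|i]; first exact: overalgebra_lin.
apply: lin_closedZ; first exact: overalgebra_lin.
apply: subalgebraX; first exact: overalgebra_subalgebra.
rewrite /overalgebra /conjset /= jordanE; split=> [p q|j|].
- rewrite addn0 mxE -val_eqE => pq /=.
  by rewrite ltn_eqF // ltn_eqF // (leq_trans pq).
- by rewrite !mxE !eqxx.
- by rewrite !mxE /=; ring: two_eq0.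
Qed.

(* Elements of the algebra are scalar plus nilpotent, so the singular ones are
   killed by the common eigenrow. *)
Lemma overalgebra_singular al (X : 'M[k]_4) :
  overalgebra al (map_mx iota X) -> \det X = 0 -> X = 0.
Proof.
move=> [Zl Zd _] detX; apply: (socle_mul_eq0 char2 a_nonsquare b4).
set Z := R *m _ *m _ in Zl Zd.
have Z0 : Z o0 o0 = 0.
  have : \det Z = 0 by rewrite !det_mulmx det_map_mx detX rmorph0 mulr0 mul0r.
  rewrite det_trig; last exact/low_trig.
  rewrite (eq_bigr (fun=> Z o0 o0)) // prodr_const => /eqP.
  by rewrite expf_eq0 => /andP[_ /eqP].
have rowZ : row o0 Z = 0.
  apply/rowP; apply: ord4P; rewrite [LHS]mxE [RHS]mxE //; exact: Zl.
have -> : \row_(j < 4) b ^+ (3 - j) = row o0 R.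
  by apply/rowP; apply: ord4P; rewrite !mxE.
move: rowZ; rewrite /Z -mulmxA row_mul mulmxA => /(congr1 (mulmx^~ R)).
by rewrite mulmxKV ?jordan_unit // mul0mx.
Qed.

Lemma overgroup_of_not_defined al : ~ defined_over iota (overgroup_of al).
Proof.
move=> Adef; have Kinf := K_infinite iota kinf.
pose e : 'cV[k]_4 := delta_mx o0 0.
(* [W] avoids the first subdiagonal, so it satisfies the linear condition. Its coefficients make it
   kill the first column of the Jordan basis, so [X0] kills the vector [e] over [k], and so does
   every [phi X0]. *)
pose W : 'M[K]_4 := b ^+ 3 *: delta_mx o3 o1 - b ^+ 2 *: delta_mx o3 o0.
pose X0 := invmx R *m W *m R.
have b0 : b != 0 by have := a_neq0 iota a_nonsquare; rewrite -b4 expf_eq0.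
have AX0 : overalgebra al X0.
  rewrite /overalgebra /conjset /= !mulmxA mulmxV ?jordan_unit // mul1mx.
  rewrite mulmxK ?jordan_unit //; split=> [p q|i|].
  - rewrite addn0 => pq; rewrite !mxE; move: p q pq.
    by apply: ord4P; apply: ord4P => //= _; ring.
  - by move: i; apply: ord4P; rewrite !mxE /=; ring.
  - by rewrite !mxE /=; ring.
have X0e : X0 *m map_mx iota e = 0.
  rewrite map_delta_mx -!mulmxA -colE.
  have -> : W *m col o0 R = 0; last by rewrite mulmx0.
  apply/colP; apply: ord4P; rewrite !mxE sum4 !mxE /=; ring.
have X00 : X0 <> 0.
  move/(congr1 (fun X => R *m X *m invmx R)); rewrite mulmx0 mul0mx.
  rewrite !mulmxA mulmxV ?jordan_unit // mul1mx mulmxK ?jordan_unit //.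
  move/matrixP/(_ o3 o1); rewrite !mxE /= mulr1 mulr0 subr0 => /eqP.
  by rewrite expf_eq0 (negbTE b0).
apply: X00; apply: (klinear_separates (iota := iota)) => phi phiL.
apply: (@overalgebra_singular al); last first.
  have : map_mx phi X0 *m e = 0.
    rewrite -(klinear_mulmx phiL) X0e; apply/matrixP => i j.
    by rewrite !mxE (klinear0 phiL).
  move=> Xe; apply/eqP/det0P.
  have : \det (map_mx phi X0)^T == 0.
    apply/det0P; exists e^T; last by rewrite -trmx_mul Xe trmx0.
    rewrite trmx_delta; apply/eqP => /matrixP/(_ 0 o0)/eqP.
    by rewrite !mxE !eqxx oner_eq0.
  by rewrite det_tr => /det0P.
rewrite overalgebra_ann => Y SY.
(* A second functional [phi'] moves [Y] to [k], where descent makes its form vanish on [X0]; then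
   [phi] can be applied to [X0] alone. *)
have trY phi' : klinear iota phi' -> \tr (map_mx phi' Y *m map_mx phi X0) = 0.
  move=> phi'L.
  have : \tr (map_mx iota (map_mx phi' Y) *m X0) = 0.
    apply: (form_eq0_units Kinf (overalgebra_lin al)) => // [|X AX Xu].
      by case: (overalgebra_subalgebra al).
    have YA g : overgroup_of al (\pi_PGL g) -> \tr (Y *m val g) = 0.
      by move=> /(pset_pi g (overalgebra_lin al)); apply: SY.
    have YA' := defined_over_form kinf phi'L Adef YA.
    by apply: (YA' (mkGL Xu)); apply/pset_pi; first exact: overalgebra_lin.
  move=> /(congr1 phi); rewrite (klinear0 phiL) (klinear_tr phiL).
  by rewrite (klinear_mulmxl phiL).
apply: contrapT => /eqP trn; have [phi' phi'L phi'1] := klinear_exists iota trn.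
move/eqP: phi'1; rewrite (klinear_tr phi'L) (klinear_mulmx phi'L) trY //.
by rewrite eq_sym oner_eq0.
Qed.

Lemma overgroup_of_inj : injective overgroup_of.
Proof.
move=> al be eL.
(* The subdiagonal of [W] is [al], 0, 1, so the condition with parameter [be] reads [al = be]. *)
pose W : 'M[K]_4 := 1%:M + (al *: delta_mx o1 o0 + delta_mx o3 o2).
have Wl : low 0 W.
  move=> p q; rewrite addn0 => pq; rewrite !mxE; move: p q pq.
  by apply: ord4P; apply: ord4P => //= _; ring.
have Wu : W \in unitmx.
  rewrite unitmxE det_trig ?unitfE; last exact/low_trig.
  apply/prodf_neq0 => i _; move: i.
  by apply: ord4P; rewrite !mxE /= ?(mulr0, addr0) oner_eq0.
have Vu : invmx R *m W *m R \in unitmx by rewrite !unitmx_mul unitmx_inv Wu jordan_unit.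
have RV : R *m (invmx R *m W *m R) *m invmx R = W.
  by rewrite !mulmxA mulmxV ?jordan_unit // mul1mx mulmxK ?jordan_unit.
have : overgroup_of al (\pi_PGL (mkGL Vu)).
  apply/pset_pi; first exact: overalgebra_lin.
  rewrite /overalgebra /conjset /= RV; split=> // [i|].
    by move: i; apply: ord4P; rewrite !mxE /=; ring.
  by rewrite !mxE /=; ring.
rewrite eL => /(pset_pi _ (overalgebra_lin be)).
rewrite /overalgebra /conjset /= RV => -[_ _]; rewrite !mxE /=.
by rewrite !(mulr0, mulr1, addr0, add0r).
Qed.

End Overgroups.

(** * Nonperfect fields of characteristic 2 and conclusion *)

Lemma nonsquare_of_nonperfect (k : fieldType) : 2%N \in [pchar k] ->
  ~ perfect_field k -> exists a : k, forall c, c ^+ 2 != a.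
Proof.
move=> char2 np; apply: contrapT => na; apply: np => p pk x.
have -> : p = 2%N.
  by have := charf_eq char2 p; rewrite pk => /esym/eqP.
apply: contrapT => nx; apply: na; exists x => c; apply/eqP => cx.
by apply: nx; exists c.
Qed.

(** Squaring is injective in characteristic 2, so on a finite field it would be surjective. *)
Lemma infinite_of_nonsquare (k : fieldType) (a : k) : 2%N \in [pchar k] ->
  (forall c, c ^+ 2 != a) -> infinite_set [set: k].
Proof.
move=> char2 na /finite_seqP[s sE].
have sall x : x \in undup s.
  by rewrite mem_undup; have : [set: k] x by []; rewrite sE.
have sqr_inj : injective (fun x : k => x ^+ 2).
  move=> x y /eqP; rewrite -subr_eq0 oppr_pchar2 // -(sqrD2 char2) expf_eq0 /=.
  by rewrite -[y]oppr_pchar2 // subr_eq0 oppr_pchar2 // => /eqP.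
have us : uniq [seq x ^+ 2 | x <- undup s] by rewrite map_inj_uniq ?undup_uniq.
have [_ /(_ a)] := uniq_min_size us (fun x _ => sall x) (eq_leq (esym (size_map _ _))).
by rewrite sall => /mapP[c _ /eqP]; rewrite eq_sym (negbTE (na c)).
Qed.

Theorem theorem1p10 (k : fieldType) (K : closedFieldType)
    (iota : {rmorphism k -> K})
    (K_algebraic : forall x : K, algebraicOver iota x)
    (char2 : 2%N \in [pchar k]) (k_nonperfect : ~ perfect_field k) :
  exists H : set (PGL K 4),
    [/\ closed_subgroup H /\ defined_over iota H,
        connected H,
        irreducible_over iota H &
        infinite_set [set L | overgroup H L /\ ~ defined_over iota L]].
Proof.
have [a na] := nonsquare_of_nonperfect char2 k_nonperfect.
have kinf := infinite_of_nonsquare char2 na.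
have [b b4] : exists b : K, b ^+ 4 = iota a.
  have [b] := @solve_monicpoly K 4 (fun i => if i == 0%N then iota a else 0) isT.
  rewrite !big_ord_recl big_ord0 /= !mul0r !addr0 expr0 mulr1 => e.
  by exists b.
exists (field_torus iota a); split.
- split; first exact: field_torus_closed_subgroup.
  exact: field_torus_defined_over.
- exact: field_torus_connected.
- by move=> P; apply: field_torus_irreducible b4 _.
(* Distinct parameters give distinct overgroups, so finitely many overgroups would make [K]
   finite. *)
have inj : injective (overgroup_of b) by move=> al be; apply: overgroup_of_inj.
move=> fin; apply: (K_infinite iota kinf).
apply: sub_finite_set (finite_preimage (in2W inj) fin).
move=> al _; split; first exact: overgroup_of_overgroup.
by move=> /(overgroup_of_not_defined char2 kinf na b4).
Qed.
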